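(* Let $R$ be a valuation domain of cardinality $\aleph_1$ and $J/R$ an essentially countable type with $J$ not countably generated. Then there is an explicitly non-standard uniserial $R$-module of type $J/R$.
   Context: A valuation domain is an integral domain whose ideals are linearly ordered; $Q$ is its quotient field. A module is uniserial if its submodules are linearly ordered. A uniserial $R$-module is standard if isomorphic to $J'/A$ for $R$-submodules $A\subseteq J'$ of $Q$, non-standard otherwise. For a uniserial $U$ and $0\neq a\in U$, $\mathrm{Ann}(a)=\{r\in R:ra=0\}$, $D(a)=\bigcup\{r^{-1}R: a\in rU\}$; $U$ has type $J/A$ if $J/A\cong D(a)/\mathrm{Ann}(a)$. A type $J/R$: $R\subseteq J\subseteq Q$, $J$ an $R$-submodule, written $J=\bigcup_{\sigma<\omega_1} r_\sigma^{-1}R$ with nonzero $r_\sigma\in R$, $r_\tau\mid r_\sigma$ and $r_\sigma\nmid r_\tau$ for $\tau<\sigma$. The type is essentially countable if there is $\gamma<\omega_1$ with $r_\gamma R/r_\sigma R$ countable for all $\gamma<\sigma<\omega_1$ (independent of the choice of the $r_\sigma$). For $U$ of type $J/R$, fix $a_\sigma\in U$ with $\mathrm{Ann}(a_\sigma)=r_\sigma R$ and let $I_\sigma$ be the set of $R$-module isomorphisms $a_\sigma R\to r_\sigma^{-1}R/R$. A special family of functions for $U$ is a family of maps $f_\sigma:I_\sigma\to\mathbb{Q}$ ($\sigma<\omega_1$) such that $f_\sigma(\psi)<f_\rho(\varphi)$ whenever $\sigma<\rho$, $\psi\in I_\sigma$, $\varphi\in I_\rho$ and $\varphi$ extends $\psi$.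 $U$ is explicitly non-standard if it has a special family of functions. *)

(* Defs.v *)
From HB Require Import structures.
From mathcomp Require Import all_boot all_order all_algebra.
From mathcomp Require Import fraction.
Set Implicit Arguments. Unset Strict Implicit. Unset Printing Implicit Defensive.
Import Order.TTheory GRing.Theory Num.Theory.
Local Open Scope ring_scope.

Notation "x %:F" := (@FracField.tofrac _ x) : ring_scope.

Definition countable_set (T : Type) (P : T -> Prop) : Prop :=
  exists g : nat -> option T, forall x, P x -> exists n, g n = Some x.

Definition omega1_order (W : Type) (lt : W -> W -> Prop) : Prop :=
  (forall x, ~ lt x x) /\
  (forall x y z, lt x y -> lt y z -> lt x z) /\
  (forall x y, lt x y \/ x = y \/ lt y x) /\
  well_founded lt /\
  (forall w, countable_set (fun x => lt x w)) /\
  ~ countable_set (fun _ : W => True).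

Definition card_aleph1 (T : Type) : Prop :=
  exists (W : Type) (lt : W -> W -> Prop) (f : W -> T),
    omega1_order lt /\ bijective f.

Definition dvd (R : idomainType) (a b : R) : Prop := exists t, b = a * t.

Definition is_ideal (R : idomainType) (I : R -> Prop) : Prop :=
  [/\ I 0, (forall x y, I x -> I y -> I (x + y)) &
      (forall r x, I x -> I (r * x))].

Definition valuation_domain (R : idomainType) : Prop :=
  forall I J : R -> Prop, is_ideal I -> is_ideal J ->
    (forall x, I x -> J x) \/ (forall x, J x -> I x).

Definition inR (R : idomainType) (x : {fraction R}) : Prop :=
  exists t : R, x = t%:F.

Definition in_invR (R : idomainType) (r : R) (x : {fraction R}) : Prop :=
  inR (x * r%:F).

(* Isomorphism of R-modules B1/A1 ~= B2/A2 for R-submodules A_i <= B_i of Q,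
   presented by a map phi : Q -> Q which is R-linear modulo A2 on B1, maps
   B1 into B2, has kernel (mod A2) exactly A1, and is onto B2 modulo A2. *)
Definition quot_iso (R : idomainType) (A1 B1 A2 B2 : {fraction R} -> Prop) : Prop :=
  exists phi : {fraction R} -> {fraction R},
    [/\ (forall x, B1 x -> B2 (phi x)),
        (forall x y (s t : R), B1 x -> B1 y ->
            A2 (phi (s%:F * x + t%:F * y) - (s%:F * phi x + t%:F * phi y))),
        (forall x, B1 x -> (A2 (phi x) <-> A1 x)) &
        (forall y, B2 y -> exists2 x, B1 x & A2 (phi x - y))].

Definition is_submodule (R : idomainType) (U : lmodType R) (P : U -> Prop) : Prop :=
  [/\ P 0, (forall x y, P x -> P y -> P (x + y)) &
      (forall (r : R) x, P x -> P (r *: x))].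

Definition uniserial (R : idomainType) (U : lmodType R) : Prop :=
  forall A B : U -> Prop, is_submodule A -> is_submodule B ->
    (forall x, A x -> B x) \/ (forall x, B x -> A x).

Definition ann_eq (R : idomainType) (U : lmodType R) (a : U) (r : R) : Prop :=
  forall s : R, s *: a = 0 <-> dvd r s.

Definition AnnQ (R : idomainType) (U : lmodType R) (a : U) (x : {fraction R}) : Prop :=
  exists2 s : R, s *: a = 0 & x = s%:F.

Definition DQ (R : idomainType) (U : lmodType R) (a : U) (x : {fraction R}) : Prop :=
  exists r : R, [/\ r != 0, (exists u : U, a = r *: u) & in_invR r x].

Definition has_type (R : idomainType) (U : lmodType R) (J : {fraction R} -> Prop) : Prop :=
  exists a : U, a != 0 /\ quot_iso (@inR R) J (AnnQ a) (DQ a).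

Definition type_presentation (R : idomainType) (J : {fraction R} -> Prop)
    (W : Type) (lt : W -> W -> Prop) (r : W -> R) : Prop :=
  [/\ (forall x, inR x -> J x),
      J 0 /\ (forall x y (s t : R), J x -> J y -> J (s%:F * x + t%:F * y)),
      (forall s, r s != 0),
      (forall t s, lt t s -> dvd (r t) (r s) /\ ~ dvd (r s) (r t)) &
      (forall x, J x <-> exists s, in_invR (r s) x)].

(* essentially countable: there is g with r_g R / r_s R countable for g < s *)
Definition ess_countable (R : idomainType) (W : Type) (lt : W -> W -> Prop)
    (r : W -> R) : Prop :=
  exists g : W, forall s, lt g s ->
    exists h : nat -> R, forall x, dvd (r g) x ->
      exists n, dvd (r s) (x - h n).

Definition countably_generated (R : idomainType) (J : {fraction R} -> Prop) : Prop :=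
  exists g : nat -> {fraction R}, (forall n, J (g n)) /\
    forall x, J x -> exists (n : nat) (c : nat -> R),
      x = \sum_(i < n) (c i)%:F * g i.

Definition in_cyc (R : idomainType) (U : lmodType R) (a x : U) : Prop :=
  exists t : R, x = t *: a.

(* psi : U -> Q represents an R-isomorphism  aR -> r^{-1}R/R  (values taken
   modulo R; only the restriction to aR matters). *)
Definition iso_rep (R : idomainType) (U : lmodType R) (a : U) (r : R)
    (psi : U -> {fraction R}) : Prop :=
  [/\ (forall x, in_cyc a x -> in_invR r (psi x)),
      (forall x y (s t : R), in_cyc a x -> in_cyc a y ->
          inR (psi (s *: x + t *: y) - (s%:F * psi x + t%:F * psi y))),
      (forall x, in_cyc a x -> (inR (psi x) <-> x = 0)) &
      (forall y, in_invR r y -> exists2 x, in_cyc a x & inR (psi x - y))].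

Definition extends_on (R : idomainType) (U : lmodType R) (a : U)
    (phi psi : U -> {fraction R}) : Prop :=
  forall x, in_cyc a x -> inR (phi x - psi x).

(* a special family of functions f_s : I_s -> rat (f s is required to be
   well defined on isomorphisms, i.e. independent of the representative) *)
Definition special_family (R : idomainType) (U : lmodType R) (W : Type)
    (lt : W -> W -> Prop) (r : W -> R) (a : W -> U)
    (f : W -> (U -> {fraction R}) -> rat) : Prop :=
  (forall s psi psi', iso_rep (a s) (r s) psi -> iso_rep (a s) (r s) psi' ->
     extends_on (a s) psi psi' -> f s psi = f s psi') /\
  (forall s p psi phi, lt s p -> iso_rep (a s) (r s) psi ->
     iso_rep (a p) (r p) phi -> extends_on (a s) phi psi ->
     f s psi < f p phi).

Definition explicitly_nonstandard (R : idomainType) (U : lmodType R) (W : Type)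
    (lt : W -> W -> Prop) (r : W -> R) : Prop :=
  (exists a : W -> U, forall s, ann_eq (a s) (r s)) /\
  (forall a : W -> U, (forall s, ann_eq (a s) (r s)) ->
     exists f, special_family lt r a f).

(* Main.v *)
(** A module of type [J/R] is a direct limit of the cyclic modules [R/r_s R] along
    multiplications by units [c_ts], where [c_ut c_ts = c_us] modulo [r_s]. An
    isomorphism [a_s R -> r_s^-1 R/R] is then a unit modulo [r_s], and it is extended by
    the unit [x] modulo [r_t] iff it equals [c_ts x]. Choosing [g] as in the definition
    of essential countability and all [c_ts] in [1 + r_g R], the tree of these
    isomorphisms splits into translates of one tree whose levels, quotients of
    [1 + r_g R], are countable.

    The [c_ts] and a strictly increasing map of that tree to the rationals are built
    together, as for a special Aronszajn tree. All nodes of a new level [d] are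
    translates of a single branch of the tree below it, so this branch has to be
    generic: it is built along a sequence cofinal in [d], keeping the rational values
    bounded along every translate, and nearly constant along suitable ones.
    This needs infinite fibres between distinct levels, so it is done on the indices [s]
    such that [[t, s[] is infinite whenever [g <= t < s]. At an arbitrary index, the
    value at the last such index below it and the distance to that index form a
    colouring by countably many colours, injective on chains; summing weights [2^-k]
    over the colours [k] seen so far, up to the current one, turns any such
    colouring into a strictly increasing map to the rationals. *)
From HB Require Import structures.
From mathcomp Require Import all_boot all_order all_algebra.
From mathcomp Require Import fraction ring lra boolp.
Set Implicit Arguments. Unset Strict Implicit. Unset Printing Implicit Defensive.
Import Order.TTheory GRing.Theory Num.Theory.
Require Import Defs.
Local Open Scope ring_scope.

(** * Equations in abelian groups *)

(** Reified terms over a list of atoms. Two terms agree in every abelian group once their integer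
    coefficients at each atom agree, which is decided by computation. *)
Inductive zexp := ZVar of nat | ZZero | ZAdd of zexp & zexp | ZOpp of zexp.

Fixpoint zval (V : zmodType) (e : seq V) (t : zexp) : V :=
  match t with
  | ZVar i => e`_i
  | ZZero => 0
  | ZAdd t1 t2 => zval e t1 + zval e t2
  | ZOpp t1 => - zval e t1
  end.

Fixpoint zcoef (t : zexp) (i : nat) : int :=
  match t with
  | ZVar j => (j == i)%:Z
  | ZZero => 0
  | ZAdd t1 t2 => zcoef t1 i + zcoef t2 i
  | ZOpp t1 => - zcoef t1 i
  end.

Lemma zvalE (V : zmodType) (e : seq V) t :
  zval e t = \sum_(i < size e) e`_i *~ zcoef t i.
Proof.
elim: t => [j||t1 IH1 t2 IH2|t IH] /=.
- have [ltj|lej] := ltnP j (size e).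
    rewrite (bigD1 (Ordinal ltj)) //= eqxx mulr1z big1 ?addr0 // => i.
    by rewrite -val_eqE /= eq_sym => /negPf ->; rewrite mulr0z.
  rewrite nth_default // big1 // => i _.
  by rewrite gtn_eqF ?mulr0z // (leq_trans (ltn_ord i)).
- by rewrite big1 // => i _; rewrite mulr0z.
- by rewrite IH1 IH2 -big_split; apply: eq_bigr => i _; rewrite mulrzDr.
- by rewrite IH -sumrN; apply: eq_bigr => i _; rewrite mulrNz.
Qed.

Lemma zval_eq (V : zmodType) (e : seq V) t1 t2 :
  all (fun i => zcoef t1 i == zcoef t2 i) (iota 0 (size e)) ->
  zval e t1 = zval e t2.
Proof.
move=> /allP E; rewrite !zvalE; apply: eq_bigr => i _.
by rewrite (eqP (E i _)) // mem_iota leq0n add0n ltn_ord.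
Qed.

Ltac zmem x e :=
  lazymatch e with
  | nil => constr:(false)
  | x :: _ => constr:(true)
  | _ :: ?e' => zmem x e'
  end.
Ltac zcollect e t :=
  lazymatch t with
  | 0 => e
  | ?a + ?b => let e1 := zcollect e a in zcollect e1 b
  | - ?a => zcollect e a
  | ?x => lazymatch zmem x e with true => e | false => constr:(x :: e) end
  end.
Ltac zindex x e :=
  lazymatch e with
  | x :: _ => constr:(O)
  | _ :: ?e' => let n := zindex x e' in constr:(S n)
  end.
Ltac zreify e t :=
  lazymatch t with
  | 0 => constr:(ZZero)
  | ?a + ?b =>
      let a' := zreify e a in let b' := zreify e b in constr:(ZAdd a' b')
  | - ?a => let a' := zreify e a in constr:(ZOpp a')
  | ?x => let n := zindex x e in constr:(ZVar n)
  end.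
Ltac abelian_group :=
  lazymatch goal with
  | |- @eq ?T ?a ?b =>
    let e0 := zcollect (@nil T) a in
    let e := zcollect e0 b in
    let a' := zreify e a in
    let b' := zreify e b in
    apply: (@zval_eq _ e a' b'); by vm_compute
  end.

(** * Powers of one half *)

Definition hpow (n : nat) : rat := 2^-1 ^+ n.

Lemma hpow_gt0 n : 0 < hpow n.
Proof. by rewrite exprn_gt0 // invr_gt0. Qed.

Lemma hpowS n : hpow n.+1 = hpow n / 2.
Proof. by rewrite /hpow exprSr. Qed.

Lemma hpow_le m n : (m <= n)%N -> hpow n <= hpow m.
Proof.
move=> /subnK <-; elim: (n - m)%N => [|k IH] //.
by rewrite addSn hpowS; have := hpow_gt0 (k + m); lra.
Qed.

Lemma hpow_small (e : rat) : 0 < e -> exists n, hpow n < e.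
Proof.
(* This linear bound turns the Archimedean property into the smallness of [hpow]. *)
move=> e0; have le1 n : n.+1%:R * hpow n <= 1.
  elim: n => [|n IH]; first by rewrite mul1r.
  have h0 := hpow_gt0 n; rewrite hpowS.
  have : 1 <= n.+1%:R :> rat by rewrite ler1n.
  by move: IH; rewrite -(natr1 n.+1); nra.
have := archi_boundP (ltW (divr_gt0 ltr01 e0)); set n := Num.bound _ => lt_n.
move: lt_n; rewrite ltr_pdivrMr // => lt_n.
exists n; rewrite -(ltr_pM2l (ltr0Sn rat n)); apply: le_lt_trans (le1 n) _.
by rewrite -natr1 mulrDl mul1r; lra.
Qed.

(** * Cocycles with a strictly increasing map *)

(** A rational substitute for the supremum: [q] is the first term of the progression [a 0 + k e]
    strictly above the sequence. The preceding term fails to bound it, hence the nearness. *)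
Lemma strict_bound_near (a : nat -> rat) (b e : rat) :
  0 < e -> (forall n, a n <= b) ->
  exists q, (forall n, a n < q) /\ (exists n, q <= a n + e).
Proof.
move=> e0 ab; pose u k := a 0%N + e *+ k.
have exk : exists k, `[< forall n, a n < u k >].
  pose N := Num.bound ((b - a 0%N) / e).
  have ba : 0 <= (b - a 0%N) / e by rewrite divr_ge0 ?subr_ge0 // ltW.
  have := archi_boundP ba; rewrite -/N ltr_pdivrMr // => lt_b.
  exists N; apply/asboolP => n; rewrite /u -mulr_natl.
  by have := ab n; lra.
have [k /asboolP uk kmin] := ex_minnP exk; exists (u k); split=> //.
case: k uk kmin => [/(_ 0%N)|k _ kmin]; first by rewrite /u addr0 ltxx.
have : ~ (forall n, a n < u k) by move/asboolP/kmin; rewrite ltnn.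
move=> /existsNP[n /negP]; rewrite -leNgt => le_n; exists n.
by move: le_n; rewrite /u mulrSr; lra.
Qed.

Section Coherent.
Variables (G : zmodType) (L : Type) (lt : L -> L -> Prop).
Hypothesis lt_trans : forall x y z, lt x y -> lt y z -> lt x z.
Hypothesis lt_irr : forall x, ~ lt x x.
Hypothesis lt_total : forall x y, lt x y \/ x = y \/ lt y x.
Hypothesis lt_wf : well_founded lt.
Hypothesis lt_count : forall d, countable_set (fun x => lt x d).
Variable K : L -> G -> Prop.
Hypothesis K0 : forall s, K s 0.
Hypothesis KB : forall s x y, K s x -> K s y -> K s (x - y).
#[local] Hint Resolve K0 : core.
Hypothesis Klt : forall s t x, lt s t -> K t x -> K s x.
Hypothesis Kcount : forall s, exists v : nat -> G, forall x, exists n, K s (x - v n).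
(** The quotient [K s / K t] is infinite: finitely many cosets of [K t] do not exhaust [K s]. *)
Hypothesis Kinf : forall s t (B : seq G), lt s t ->
  exists k, K s k /\ forall b, b \in B -> ~ K t (k - b).

Let le s t := s = t \/ lt s t.

Lemma KN s x : K s x -> K s (- x).
Proof. by move=> Kx; rewrite -sub0r; apply: KB. Qed.

Lemma KD s x y : K s x -> K s y -> K s (x + y).
Proof. by move=> Kx Ky; rewrite -[y]opprK; apply/KB/KN. Qed.

Lemma Kle s t x : le s t -> K t x -> K s x.
Proof. by case=> [->//|]; exact: Klt. Qed.

Lemma leL_lt_trans s t u : le s t -> lt t u -> lt s u.
Proof. by case=> [->//|]; exact: lt_trans. Qed.

Lemma leL_trans s t u : le s t -> le t u -> le s u.
Proof. by move=> st [<-//|tu]; right; apply: leL_lt_trans tu. Qed.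

(* The last clause (points lift to level [d] simultaneously for finitely many
   translates, at an arbitrarily small cost) keeps the recursion going. *)
Definition stage d (c : L -> L -> G) (f : L -> G -> rat) (cd : L -> G)
    (fd : G -> rat) : Prop :=
  [/\ forall s t, lt s t -> lt t d -> K s (cd t + c t s - cd s),
      forall x y, K d (x - y) -> fd x = fd y,
      forall s v, lt s d -> f s (cd s + v) < fd v
    & forall s x (F : seq G) e, lt s d -> 0 < e ->
        exists y, K s (y + cd s - x) /\
          forall v, v \in F -> fd (y + v) <= f s (x + v) + e].

(** Running maximum of an enumeration of the levels below [d]. At a successor it is eventually
    constant, so successor and limit levels need no separate treatment. *)
Lemma cofinal_sequence d s0 : lt s0 d ->
  exists sg : nat -> L, [/\ forall n, lt (sg n) d,
    forall n, le (sg n) (sg n.+1) & forall s, lt s d -> exists n, le s (sg n)].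
Proof.
move=> s0d; have [e eP] := lt_count d.
pose x n := if e n is Some y then if `[< lt y d >] then y else s0 else s0.
have xd n : lt (x n) d.
  by rewrite /x; case: (e n) => // y; case: asboolP.
pose fix sg n := if n is m.+1 then
  (if `[< lt (sg m) (x m) >] then x m else sg m) else s0.
have sg_le n : le (sg n) (sg n.+1).
  by rewrite /=; case: asboolP => ?; [right|left].
exists sg; split=> //.
  by elim=> [|n IH] //=; case: ifP.
move=> s sd; have [n en] := eP _ sd; exists n.+1.
have xn : x n = s by rewrite /x en asboolT.
rewrite /= xn; case: asboolP => [_|]; first by left.
by case: (lt_total (sg n) s) => [//|[->|]]; [left|right].
Qed.

(** * Construction of a new level *)

Section Step.
Variables (d : L) (c : L -> L -> G) (f : L -> G -> rat).
Hypothesis prev : forall t, lt t d -> stage t c f (c t) (f t).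

(** The value 0 on the diagonal lets the clauses of [stage] be used for [le] instead of [lt]. *)
Let C t s := if `[< lt s t >] then c t s else 0.

Let Clt t s : lt s t -> C t s = c t s.
Proof. by move=> st; rewrite /C asboolT. Qed.

Let Cid t : C t t = 0.
Proof. by rewrite /C asboolF. Qed.

Let Ccoh s t u : le s t -> le t u -> lt u d -> K s (C u t + C t s - C u s).
Proof.
move=> [->|st] tu ud; first by rewrite Cid addr0 subrr.
case: tu ud => [<-|tu] ud; first by rewrite Cid add0r subrr.
rewrite !Clt //; last exact: lt_trans tu.
by case: (prev ud) => + _ _ _; apply.
Qed.

Let Cinv s x y : lt s d -> K s (x - y) -> f s x = f s y.
Proof. by move=> sd; case: (prev sd) => _ + _ _; apply. Qed.

Let Cmono s t v : le s t -> lt t d -> f s (C t s + v) <= f t v.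
Proof.
move=> [->|st] td; first by rewrite Cid add0r.
by rewrite Clt //; case: (prev td) => _ _ + _ => /(_ _ v st)/ltW.
Qed.

Let Cext s t x (F : seq G) e : le s t -> lt t d -> 0 < e ->
  exists y, K s (y + C t s - x) /\
    forall v, v \in F -> f t (y + v) <= f s (x + v) + e.
Proof.
move=> [->|st] td e0.
  by exists x; rewrite Cid addr0 subrr; split=> // v _; rewrite lerDl ltW.
by rewrite Clt //; case: (prev td) => _ _ _; apply.
Qed.

Variables (sg : nat -> L) (v : nat -> G).
Hypothesis sg_lt : forall n, lt (sg n) d.
Hypothesis sg_le : forall n, le (sg n) (sg n.+1).
Hypothesis sg_cof : forall s, lt s d -> exists n, le s (sg n).
Hypothesis vP : forall x, exists n, K d (x - v n).

Let sg_mono m n : (m <= n)%N -> le (sg m) (sg n).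
Proof.
move=> /subnK <-; elim: (n - m)%N => [|k IH]; first by left.
by rewrite addSn; apply: leL_trans IH (sg_le _).
Qed.

Let Kd s x : lt s d -> K d x -> K s x.
Proof. by move=> sd; apply: Klt. Qed.

(* [w] translates the branch through [y] at level [sg n] so that it passes near
   [v i] at level [sg k], while avoiding the first [n] classes modulo [K d]. *)
Let target n y w k i :=
  [/\ K (sg k) (w + y + C (sg n) (sg k) - v i),
      forall l, (l <= n)%N ->
        f (sg n) (y + w + v l) <= f (sg k) (v i + v l) + hpow n
    & forall l j, (l <= n)%N -> (j <= n)%N -> ~ K d (w + v l - v j)].

(** The point [v i] is lifted to some [z] at level [sg n], then moved by an element of [K (sg n)].
    This changes nothing at level [sg n], while [Kinf] lets it avoid the finitely many forbidden
    classes modulo [K d]. *)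
Let target_ex n y k i : (k <= n)%N -> exists w, target n y w k i.
Proof.
move=> kn; have [z [zK zf]] := @Cext (sg k) (sg n) (v i) [seq v l | l <- iota 0 n.+1]
  (hpow n) (sg_mono kn) (sg_lt n) (hpow_gt0 n).
pose B := [seq v j - v l - (z - y) | j <- iota 0 n.+1, l <- iota 0 n.+1].
have [kp [kpK kpB]] := Kinf B (sg_lt n).
exists (z - y + kp); split.
- have -> : z - y + kp + y + C (sg n) (sg k) - v i =
    (z + C (sg n) (sg k) - v i) + kp by abelian_group.
  by apply: KD => //; apply: Kle kpK; apply: sg_mono.
- move=> l ln; rewrite (@Cinv (sg n) _ (z + v l)) //.
    by apply: zf; apply: map_f; rewrite mem_iota.
  by have -> : y + (z - y + kp) + v l - (z + v l) = kp by abelian_group.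
- move=> l j ln jn; have -> : z - y + kp + v l - v j =
    kp - (v j - v l - (z - y)) by abelian_group.
  by apply: kpB; apply/allpairsP; exists (j, l); rewrite !mem_iota.
Qed.

(** [A] is a finite list of translations along which the branch must stay nearly constant after step
    [n]: the first representatives [v l], and their sums with one target [w] for each pair [k],
    [i]. *)
Let protects n y (A : seq G) :=
  (forall l, (l <= n)%N -> v l \in A) /\
  forall k i, (k <= n)%N -> (i <= n)%N ->
    exists w, target n y w k i /\ forall l, (l <= n)%N -> w + v l \in A.

Let protects_ex n y : exists A, protects n y A.
Proof.
have /choice[w wP] : forall p : nat * nat, exists w,
    (p.1 <= n)%N -> target n y w p.1 p.2.
  move=> [k i] /=; have [kn|nk] := boolP (k <= n)%N; last by exists 0.
  by have [w ?] := target_ex y i kn; exists w.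
pose I := iota 0 n.+1.
exists (map v I ++ [seq w p + v l | p <- [seq (k, i) | k <- I, i <- I], l <- I]).
have inI l : (l <= n)%N -> l \in I by move=> ln; rewrite mem_iota.
split=> [l ln|k i kn i_n]; first by rewrite mem_cat map_f // inI.
exists (w (k, i)); split; first exact: (wP (k, i)).
move=> l ln; rewrite mem_cat; apply/orP; right.
apply/allpairsPdep; exists (k, i), l; split=> //; last exact: inI.
by apply/allpairsPdep; exists k, i; rewrite !inI.
Qed.

(** Recursion on pairs: the last clause of [stage] lifts [y n] at cost [hpow n] along [A n], and
    then [A n] is enlarged by the list protecting the new point. *)
Let branch_ex : exists (y : nat -> G) (A : nat -> seq G),
  [/\ forall n, protects n (y n) (A n),
      forall n, {subset A n <= A n.+1},
      forall n, K (sg n) (y n.+1 + C (sg n.+1) (sg n) - y n)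
    & forall n a, a \in A n ->
        f (sg n.+1) (y n.+1 + a) <= f (sg n) (y n + a) + hpow n].
Proof.
have /choice[P PP] : forall p : nat * G, exists A, protects p.1 p.2 A.
  by move=> p; apply: protects_ex.
have /choice[Y YP] : forall p : nat * G * seq G, exists y,
    K (sg p.1.1) (y + C (sg p.1.1.+1) (sg p.1.1) - p.1.2) /\
    forall a, a \in p.2 -> f (sg p.1.1.+1) (y + a) <=
      f (sg p.1.1) (p.1.2 + a) + hpow p.1.1.
  by move=> p; apply: Cext => //; apply: hpow_gt0.
pose fix st n := if n is m.+1 then
    (let y := Y (m, (st m).1, (st m).2) in (y, (st m).2 ++ P (m.+1, y)))
  else (0, P (0%N, 0)).
exists (fun n => (st n).1), (fun n => (st n).2); split.
- case=> [|n] /=; first exact: (PP (0%N, 0)).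
  have [P1 P2] := PP (n.+1, Y (n, (st n).1, (st n).2)).
  split=> [l ln|k i kn i_n]; first by rewrite mem_cat P1 ?orbT.
  have [w [tw wA]] := P2 _ _ kn i_n; exists w; split=> // l ln.
  by rewrite mem_cat wA ?orbT.
- by move=> n a /= an; rewrite mem_cat an.
- by move=> n; case: (YP (n, (st n).1, (st n).2)).
- by move=> n a; case: (YP (n, (st n).1, (st n).2)) => _; apply.
Qed.

Lemma stage_step : exists cd fd, stage d c f cd fd.
Proof.
have [y [A [yA A_sub yK yf]]] := branch_ex.
(* Value at level [sg n] on the translate by [x] of the branch; it is nondecreasing in [n], and
   [fd x] will be a strict upper bound. *)
pose a n x := f (sg n) (y n + x).
have a_S n x : a n x <= a n.+1 x.
  rewrite /a -(@Cinv (sg n) (C (sg n.+1) (sg n) + (y n.+1 + x))) //.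
    exact: Cmono.
  have -> : C (sg n.+1) (sg n) + (y n.+1 + x) - (y n + x) =
    y n.+1 + C (sg n.+1) (sg n) - y n by abelian_group.
  exact: yK.
have a_mono x m n : (m <= n)%N -> a m x <= a n x.
  move=> /subnK <-; elim: (n - m)%N => [|k IH] //.
  by rewrite addSn; apply: le_trans IH (a_S _ _).
have a_inv n x x' : K d (x - x') -> a n x = a n x'.
  move=> xx'; apply: Cinv => //; apply: Kd => //.
  by have -> : y n + x - (y n + x') = x - x' by abelian_group.
(* The costs from step [n] on sum to less than [2 * hpow n]; the induction shows that [a] plus the
   remaining allowance does not increase. *)
have a_prot n x m : x \in A n -> (n <= m)%N -> a m x <= a n x + 2 * hpow n.
  move=> xA /subnK <-; set k := (m - n)%N.
  suff [] : x \in A (k + n)%N /\ a (k + n)%N x + 2 * hpow (k + n) <= a n x + 2 * hpow n.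
    by have := hpow_gt0 (k + n); lra.
  elim: k => [|k [IH1 IH2]] //; rewrite addSn; split; first exact: A_sub.
  by have := yf _ _ IH1; rewrite -/(a _ _) -/(a _ _) hpowS; lra.
have a_bound l n : a n (v l) <= a l (v l) + 2 * hpow l.
  have [nl|ln] := leqP n l.
    by have := a_mono (v l) _ _ nl; have := hpow_gt0 l; lra.
  by apply: a_prot (ltnW ln); case: (yA l) => + _; apply.
have /choice[Q QP] : forall l, exists q,
    (forall n, a n (v l) < q) /\ (exists n, q <= a n (v l) + hpow l).
  by move=> l; apply: strict_bound_near (hpow_gt0 l) (a_bound l).
(* Taking the least index of a representative makes [fd] depend only on the class modulo [K d]. The
   slack [hpow (idx x)] in the bound shrinks as the index grows. *)
have exidx x : exists l, `[< K d (x - v l) >].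
  by have [l Kl] := vP x; exists l; apply/asboolP.
pose idx x := ex_minn (exidx x).
have idxP x : K d (x - v (idx x)).
  by rewrite /idx; case: ex_minnP => l /asboolP.
have idx_min x l : K d (x - v l) -> (idx x <= l)%N.
  by move=> xl; rewrite /idx; case: ex_minnP => m _; apply; apply/asboolP.
pose fd x := Q (idx x).
have fd_gt x n : a n x < fd x.
  by rewrite (a_inv _ _ _ (idxP x)); case: (QP (idx x)).
have fd_le x : exists n, fd x <= a n x + hpow (idx x).
  by have [_ [n]] := QP (idx x); exists n; rewrite (a_inv _ _ _ (idxP x)).
have fd_inv x x' : K d (x - x') -> fd x = fd x'.
  move=> xx'; rewrite /fd; congr Q; apply/eqP; rewrite eqn_leq.
  apply/andP; split; apply: idx_min.
    have -> : x - v (idx x') = (x - x') + (x' - v (idx x')) by abelian_group.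
    exact: KD.
  have -> : x' - v (idx x) = (x - v (idx x)) - (x - x') by abelian_group.
  exact: KB.
have exn s : exists n, lt s d -> le s (sg n).
  have [sd|nsd] := pselect (lt s d); last by exists 0%N.
  by have [n ?] := sg_cof sd; exists n.
have /choice[nu nuP] := exn.
(* The trace of the branch at level [s]; by [cdE] every stage [m] with [sg m] above [s] gives the
   same class modulo [K s]. *)
pose cd s := y (nu s) + C (sg (nu s)) s.
have yC_S s m : lt s d -> le s (sg m) ->
    K s (y m.+1 + C (sg m.+1) s - (y m + C (sg m) s)).
  move=> sd sm.
  have -> : y m.+1 + C (sg m.+1) s - (y m + C (sg m) s) =
    (y m.+1 + C (sg m.+1) (sg m) - y m) -
    (C (sg m.+1) (sg m) + C (sg m) s - C (sg m.+1) s) by abelian_group.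
  by apply: KB; [exact: Kle (yK m)|exact: Ccoh].
have yC_mono s m n : lt s d -> le s (sg m) -> (m <= n)%N ->
    K s (y n + C (sg n) s - (y m + C (sg m) s)).
  move=> sd sm /subnK <-; elim: (n - m)%N => [|k IH]; first by rewrite subrr.
  rewrite addSn.
  set u := y _ + _; set u' := y m + _ in IH *; set u'' := y _ + _ in IH.
  have -> : u - u' = (u - u'') + (u'' - u') by abelian_group.
  apply: KD => //; apply: yC_S => //; apply: leL_trans sm _.
  by apply: sg_mono; rewrite leq_addl.
have cdE s m : lt s d -> le s (sg m) -> K s (cd s - (y m + C (sg m) s)).
  move=> sd sm; rewrite /cd; have [mn|nm] := leqP m (nu s); first exact: yC_mono.
  rewrite -opprB; apply: KN; apply: yC_mono (ltnW nm) => //.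
  exact: nuP.
exists cd, fd; split=> //.
- move=> s t st td; have sd := lt_trans st td.
  have [m tm] := sg_cof td.
  have sm : le s (sg m) by right; case: tm => [<-//|]; apply: lt_trans st.
  have -> : cd t + c t s - cd s = (cd t - (y m + C (sg m) t)) -
     (cd s - (y m + C (sg m) s)) + (C (sg m) t + c t s - C (sg m) s)
    by abelian_group.
  apply: KD; last by rewrite -(Clt st); apply: Ccoh => //; right.
  by apply: KB; [apply: Klt st _|]; apply: cdE.
- move=> s x sd; have [m sm] := sg_cof sd.
  rewrite (@Cinv s _ (C (sg m) s + (y m + x))) //; last first.
    have -> : cd s + x - (C (sg m) s + (y m + x)) =
      cd s - (y m + C (sg m) s) by abelian_group.
    exact: cdE.
  exact: le_lt_trans (Cmono _ sm (sg_lt m)) (fd_gt x m).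
(* Error budget: [e / 2] for lifting [x] to [z] at a level [sg k], and [4 * hpow n < e / 2] for the
   rest: one [hpow n] from the target, two from protection, one from the slack of [fd]. *)
move=> s x F e sd e0; have [k sk] := sg_cof sd.
have e2 : 0 < e / 2 by lra.
have [z [zK zf]] := Cext x F sk (sg_lt k) e2.
have [i zi] := vP z.
have [j hj] : exists j, hpow j < e / 8 by apply: hpow_small; lra.
have [N NP] : exists N, forall b, b \in F -> exists l, (l <= N)%N /\ K d (b - v l).
  elim: (F) => [|b F' [N NP]]; first by exists 0%N.
  have [l bl] := vP b; exists (maxn N l) => b'; rewrite inE => /orP[/eqP->|].
    by exists l; rewrite leq_maxr.
  by move=> /NP[l' [l'N ?]]; exists l'; split=> //; rewrite leq_max l'N.
pose n := maxn (maxn k i) (maxn j N).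
have kn : (k <= n)%N by rewrite /n !leq_max leqnn.
have i_n : (i <= n)%N by rewrite /n !leq_max leqnn orbT.
have jn : (j <= n)%N by rewrite /n !leq_max leqnn !orbT.
have Nn : (N <= n)%N by rewrite /n !leq_max leqnn !orbT.
have [_ /(_ k i kn i_n)[w [[wK wf wd] wA]]] := yA n.
exists w; split.
  have sn : le s (sg n) by apply: leL_trans sk (sg_mono kn).
  have -> : w + cd s - x = (cd s - (y n + C (sg n) s)) +
    (w + y n + C (sg n) (sg k) - v i) -
    (C (sg n) (sg k) + C (sg k) s - C (sg n) s) -
    (z - v i) + (z + C (sg k) s - x) + (v i - v i) by abelian_group.
  rewrite subrr addr0; apply: KD => //; apply: KB; last exact: Kd.
  apply: KB; last by apply: Ccoh => //; apply: sg_mono.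
  by apply: KD; [exact: cdE|exact: Kle wK].
move=> b bF; have [l [lN bl]] := NP _ bF; have ln := leq_trans lN Nn.
rewrite (@fd_inv _ (w + v l)); last first.
  by have -> : w + b - (w + v l) = b - v l by abelian_group.
have [m] := fd_le (w + v l).
(* The translate avoids the first [n + 1] classes modulo [K d], so its slack is at most [hpow n]. *)
have idx_n : (n < idx (w + v l)%R)%N.
  by rewrite ltnNge; apply/negP => /(wd _ _ ln); apply; apply: idxP.
have := hpow_le (ltnW idx_n); have := hpow_le jn.
have : a m (w + v l) <= a n (w + v l) + 2 * hpow n.
  apply: le_trans (a_mono _ _ _ (leq_maxr n m)) _.
  by apply: a_prot (leq_maxl _ _); apply: wA.
have := wf _ ln; rewrite -addrA -/(a n (w + v l)).
rewrite (@Cinv (sg k) (v i + v l) (z + b)) //; last first.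
  have -> : v i + v l - (z + b) = - ((z - v i) + (b - v l)) by abelian_group.
  by apply: Kd => //; apply: KN; apply: KD.
have := zf _ bF; lra.
Qed.

End Step.

(** Well-founded recursion on the level, choosing [c d] and [f d] together by [stage_step]; a
    minimal level takes zero functions. *)
Theorem coherent_specialization : exists (c : L -> L -> G) (f : L -> G -> rat),
  [/\ forall s t u, lt s t -> lt t u -> K s (c u t + c t s - c u s),
      forall s x y, K s (x - y) -> f s x = f s y
    & forall s t x, lt s t -> f s (c t s + x) < f t x].
Proof.
have step d c f : (forall t, lt t d -> stage t c f (c t) (f t)) ->
    exists p, stage d c f p.1 p.2.
  move=> prev; have [[s0 s0d]|nd] := pselect (exists s, lt s d); last first.
    have nlt s : ~ lt s d by move=> sd; apply: nd; exists s.
    exists (fun=> 0, fun=> 0); split=> //= [s t _|s x|s x F e] td; by case: (nlt _ td).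
  have [sg [sg_lt sg_le sg_cof]] := cofinal_sequence s0d.
  have [v vP] := Kcount d.
  by have [cd [fd ?]] := stage_step prev sg_lt sg_le sg_cof vP; exists (cd, fd).
pose T := ((L -> G) * (G -> rat))%type.
pose junk : T := (fun=> 0, fun=> 0).
pose stg d (D : L -> T) (p : T) :=
  stage d (fun t => (D t).1) (fun t => (D t).2) p.1 p.2.
have stg_ext d D D' p : (forall t, lt t d -> D t = D' t) -> stg d D p -> stg d D' p.
  move=> DD' [h1 h2 h3 h4]; split=> //.
  - by move=> s t st td; rewrite -DD' //; apply: h1.
  - by move=> s x sd; rewrite -DD' //; apply: h3.
  - by move=> s x F e sd e0; rewrite -DD' //; apply: h4.
have /choice[next nextP] : forall q : L * (L -> T), exists p,
    (exists p', stg q.1 q.2 p') -> stg q.1 q.2 p.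
  move=> q; have [[p ?]|no] := pselect (exists p', stg q.1 q.2 p'); first by exists p.
  by exists junk.
(* [next] acts on total functions, so the values below [d] are completed by [junk], which a stage at
   [d] does not see by [stg_ext]. *)
pose tot d (g : forall t, lt t d -> T) t :=
  if pselect (lt t d) is left td then g t td else junk.
pose F d (g : forall t, lt t d -> T) := next (d, tot d g).
pose D := Fix lt_wf (fun=> T) F.
have DE d : D d = next (d, tot d (fun t _ => D t)).
  rewrite /D Fix_eq // => x g g' gg'; congr (next (_, _)).
  by apply/funext => t; rewrite /tot; case: pselect.
have totE d t : lt t d -> tot d (fun t _ => D t) t = D t.
  by move=> td; rewrite /tot; case: pselect.
have DP d : stg d D (D d).
  elim/(well_founded_ind lt_wf): d => d IH.
  rewrite DE; apply: (stg_ext d _ _ _ (totE d)).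
  apply: (nextP (d, tot d (fun t _ => D t))) => /=; have [p pP] := step d _ _ IH.
  by exists p; apply: (stg_ext d D _ p _ pP) => t td; rewrite totE.
exists (fun t => (D t).1), (fun t => (D t).2); split.
- by move=> s t u st tu; case: (DP u) => + _ _ _; apply.
- by move=> s x y; case: (DP s) => _ + _ _; apply.
- by move=> s t x st; case: (DP t) => _ _ + _; apply.
Qed.

End Coherent.

(** * Valuation domains and limit levels *)

Section Divisibility.
Variable R : idomainType.
Implicit Types a b c g x y : R.

Lemma dvd_refl a : dvd a a.
Proof. by exists 1; rewrite mulr1. Qed.

Lemma dvd_trans a b c : dvd a b -> dvd b c -> dvd a c.
Proof. by move=> [x ->] [y ->]; exists (x * y); rewrite mulrA. Qed.

Lemma dvd0 a : dvd a 0.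
Proof. by exists 0; rewrite mulr0. Qed.

Lemma dvdD a x y : dvd a x -> dvd a y -> dvd a (x + y).
Proof. by move=> [s ->] [t ->]; exists (s + t); rewrite mulrDr. Qed.

Lemma dvdN a x : dvd a x -> dvd a (- x).
Proof. by move=> [s ->]; exists (- s); rewrite mulrN. Qed.

Lemma dvdB a x y : dvd a x -> dvd a y -> dvd a (x - y).
Proof. by move=> ax ay; apply/dvdD/dvdN. Qed.

Lemma dvd_mulr a x y : dvd a x -> dvd a (x * y).
Proof. by move=> [s ->]; exists (s * y); rewrite mulrA. Qed.

Lemma dvd_mull a x y : dvd a x -> dvd a (y * x).
Proof. by rewrite mulrC; apply: dvd_mulr. Qed.

Lemma dvd1P x : dvd x 1 <-> x \is a GRing.unit.
Proof.
split=> [[y xy]|ux]; last by exists x^-1; rewrite divrr.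
by apply/unitrPr; exists y.
Qed.

Lemma dvd_unit_mull a u x : u \is a GRing.unit -> dvd a (u * x) -> dvd a x.
Proof. by move=> uu /(dvd_mull u^-1); rewrite mulKr. Qed.

Hypothesis HR : valuation_domain R.

Lemma dvd_total a b : dvd a b \/ dvd b a.
Proof.
have idl x : is_ideal (dvd x).
  by split=> [|y z|s y]; [exact: dvd0|exact: dvdD|exact: dvd_mull].
by case: (HR (idl a) (idl b)) => h; [right|left]; apply: h; apply: dvd_refl.
Qed.

(** A valuation domain is local: if [x] divides [g] it divides the unit [u]; otherwise [g] would
    divide [u]. *)
Lemma unit_congr g u x : ~ dvd g 1 -> u \is a GRing.unit -> dvd g (x - u) ->
  x \is a GRing.unit.
Proof.
move=> g1 uu gxu; apply/dvd1P; case: (dvd_total x g) => [xg|gx].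
  have : dvd x (u * 1).
    rewrite mulr1 -[u](subKr x); apply: dvdB; first exact: dvd_refl.
    exact: dvd_trans gxu.
  exact: dvd_unit_mull.
case: g1; apply: (@dvd_unit_mull _ u) => //.
by rewrite mulr1 -[u](subKr x); apply: dvdB.
Qed.

(* The group [1 + gR], carried by [R] itself through [x |-> 1 + g x]. *)
Lemma principal_unit_group g : ~ dvd g 1 ->
  exists (G : zmodType) (j : G -> R),
    [/\ j 0 = 1, forall x y : G, j (x + y) = j x * j y,
        forall x : G, dvd g (j x - 1) & forall y, dvd g (y - 1) -> exists x : G, j x = y].
Proof.
move=> g1; pose j x := 1 + g * x.
have ju x : j x \is a GRing.unit.
  apply: (unit_congr g1 (unitr1 R)).
  by rewrite /j addrAC subrr add0r; exists x.
pose op x y := x + y + g * x * y.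
have opA : associative op by move=> x y z; rewrite /op; ring.
have opC : commutative op by move=> x y; rewrite /op; ring.
have op0 : left_id 0 op by move=> x; rewrite /op; ring.
have opN : left_inverse 0 (fun x => - x / j x) op.
  move=> x; apply: (mulIr (ju x)); rewrite mul0r /op.
  have -> : (- x / j x + x + g * (- x / j x) * x) * j x =
    - x / j x * j x * (1 + g * x) + x * j x by ring.
  by rewrite divrK // /j; ring.
pose zm := GRing.isZmodule.Build R opA opC op0 opN.
pose Z : zmodType := HB.pack (R : Type) (Choice.on R) zm.
exists Z, j; split.
- by rewrite /j mulr0 addr0.
- by move=> x y; rewrite -[(x + y)%R]/(op x y) /j /op; ring.
- by move=> x; rewrite /j addrAC subrr add0r; exists x.
- by move=> y [x yx]; exists x; rewrite /j -yx addrC subrK.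
Qed.

End Divisibility.

Lemma sig_total (W : Type) (lt : W -> W -> Prop) (P : W -> Prop) :
  (forall x y, lt x y \/ x = y \/ lt y x) -> forall s t : {x | P x},
  lt (sval s) (sval t) \/ s = t \/ lt (sval t) (sval s).
Proof.
move=> tot [s Ps] [t Pt] /=; case: (tot s t) => [|[E|]]; auto.
by right; left; apply: eq_exist.
Qed.

(** * Limit indices in an order of type omega_1 *)

Section Order.
Variables (W : Type) (lt : W -> W -> Prop).
Hypothesis HW : omega1_order lt.

Let le s t := s = t \/ lt s t.

Let lt_irr x : ~ lt x x. Proof. by case: HW. Qed.
Let lt_trans x y z : lt x y -> lt y z -> lt x z.
Proof. by case: HW => _ [+ _]; apply. Qed.
Let lt_total x y : lt x y \/ x = y \/ lt y x.
Proof. by case: HW => _ [_ [+ _]]; apply. Qed.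
Let lt_wf : well_founded lt. Proof. by case: HW => _ [_ [_ []]]. Qed.
Let le_lt x y z : le x y -> lt y z -> lt x z.
Proof. by case=> [->//|]; apply: lt_trans. Qed.
Let lt_le x y z : lt x y -> le y z -> lt x z.
Proof. by move=> xy [<-//|]; apply: lt_trans. Qed.
Let le_trans x y z : le x y -> le y z -> le x z.
Proof. by move=> xy [<-//|yz]; right; apply: le_lt yz. Qed.
Let leNlt x y : ~ lt x y -> le y x.
Proof. by case: (lt_total x y) => [//|[->|]]; [left|right]. Qed.

Lemma countable_setU (T : Type) (P Q : T -> Prop) :
  countable_set P -> countable_set Q -> countable_set (fun x => P x \/ Q x).
Proof.
move=> [g gP] [h hQ]; exists (fun n => if odd n then h n./2 else g n./2) => x [].
  by move=> /gP[n gn]; exists n.*2; rewrite odd_double doubleK.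
by move=> /hQ[n hn]; exists n.*2.+1; rewrite /= odd_double /= uphalf_double.
Qed.

Lemma countable_set_inj (T : Type) (P : T -> Prop) (h : T -> nat) :
  (forall x y, P x -> P y -> h x = h y -> x = y) -> countable_set P.
Proof.
move=> hinj; have /choice[g gP] : forall n, exists o, forall x, P x -> h x = n -> o = Some x.
  move=> n; have [[x [Px hx]]|no] := pselect (exists x, P x /\ h x = n).
    by exists (Some x) => y Py hy; congr Some; apply: hinj; rewrite ?hx ?hy.
  by exists None => x Px hx; case: no; exists x.
by exists g => x Px; exists (h x); apply: gP.
Qed.

Lemma omega1_unbounded s : exists t, lt s t.
Proof.
apply: contrapT => no; case: HW => _ [_ [_ [_ [/(_ s) cnt]]]]; apply.
have [g gP] := countable_setU cnt (@countable_set_inj _ (eq s) (fun=> 0%N)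
  (fun x y sx sy _ => etrans (esym sx) sy)).
exists g => x _; apply: gP; case: (lt_total s x) => [sx|[]]; auto.
by case: no; exists x.
Qed.

(** The interval [[a, b[] has at most [n] elements; the list may repeat entries or leave the
    interval. *)
Let covers a b n := exists e : nat -> W,
  forall x, le a x -> lt x b -> exists i, (i < n)%N /\ e i = x.
Let fin a b := exists n, covers a b n.

Let covers0 a : covers a a 0.
Proof. by exists (fun=> a) => x ax xa; case: (lt_irr (le_lt ax xa)). Qed.

Let fin_trans a b c : fin a b -> fin b c -> fin a c.
Proof.
move=> [n [e eP]] [m [e' eP']]; exists (n + m)%N.
exists (fun i => if (i < n)%N then e i else e' (i - n)%N) => x ax xc.
have [/(eP _ ax)[i [i_n ei]]|/leNlt bx] := pselect (lt x b).
  by exists i; rewrite i_n ltn_addr.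
have [i [im ei]] := eP' _ bx xc; exists (n + i)%N.
by rewrite ltn_add2l im ltnNge leq_addr addKn.
Qed.

Let fin_sub a b a' b' : fin a b -> le a a' -> le b' b -> fin a' b'.
Proof.
move=> [n [e eP]] aa' bb'; exists n, e => x ax xb.
by apply: eP; [exact: le_trans ax|exact: lt_le bb'].
Qed.

(** The element [s] lies in [[a, t[] but not in [[a, s[]: its entry in the list is overwritten by
    the last one and the list shortened. *)
Let covers_strict a s t n : le a s -> lt s t -> covers a t n ->
  exists m, (m < n)%N /\ covers a s m.
Proof.
move=> as_ st [e eP]; have [i0 [i0n ei0]] := eP _ as_ st.
case: n => // n in eP i0n *; exists n; split=> //.
exists (fun i => if i == i0 then e n else e i) => x ax xs.
have [i [i_n ei]] := eP _ ax (lt_trans xs st).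
have ii0 : i != i0.
  by apply: contra_notN (@lt_irr s) => /eqP ii0; rewrite -{1}ei0 -ii0 ei.
move: i_n; rewrite ltnS leq_eqVlt => /orP[/eqP i_n|i_n].
  exists i0; rewrite eqxx -i_n ei; split=> //.
  by move: i0n; rewrite ltnS leq_eqVlt -i_n eq_sym (negPf ii0).
by exists i; rewrite (negPf ii0).
Qed.

Variable g : W.
(** Indices not reached in finitely many steps from a smaller index above or equal to [g]; [g]
    itself qualifies vacuously. *)
Let limit s := le g s /\ forall x, le g x -> lt x s -> ~ fin x s.

Let limit_below s : le g s -> exists x, [/\ limit x, le x s & fin x s].
Proof.
elim/(well_founded_ind lt_wf): s => s IH gs.
have [ls|nls] := pselect (limit s).
  by exists s; split=> //; [left|exists 0%N].
have [x [gx xs fx]] : exists x, [/\ le g x, lt x s & fin x s].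
  apply: contrapT => no; apply: nls; split=> // x gx xs fx.
  by apply: no; exists x.
have [y [ly yx fy]] := IH _ xs gx; exists y; split=> //.
  exact: le_trans yx (or_intror xs).
exact: fin_trans fx.
Qed.

Let numP a b : exists n, fin a b -> covers a b n /\ forall m, covers a b m -> (n <= m)%N.
Proof.
have [fab|] := pselect (fin a b); last by exists 0%N.
have ex : exists n, `[< covers a b n >] by case: fab => n ?; exists n; apply/asboolP.
have [n /asboolP cn nmin] := ex_minnP ex; exists n => _; split=> // m /asboolP.
exact: nmin.
Qed.

(** With no limit index beyond [x], every later index would be at finite distance from [x]. This
    distance is strictly increasing, so [W] would be countable. *)
Let limit_cofinal s : exists t, limit t /\ lt s t.
Proof.
suff h x : le g x -> exists t, limit t /\ lt x t.
  have [gs|/leNlt sg] := pselect (lt g s); first by apply: h; right.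
  have [|t [lt_ gt]] := h g; first by left.
  by exists t; split=> //; apply: le_lt gt.
move=> {s} gx; apply: contrapT => no.
have finx t : lt x t -> fin x t.
  move=> xt; have [y [ly yt fy]] := limit_below (or_intror (le_lt gx xt)).
  have yx : le y x by apply: leNlt => xy; apply: no; exists y.
  by apply: fin_sub fy yx _; left.
have /choice[num numx] := numP x.
have cnt : countable_set (fun t => le x t).
  apply: (@countable_set_inj _ _ num).
  have finx' t : le x t -> fin x t by case=> [<-|/finx//]; exists 0%N.
  have mono s t : le x s -> lt s t -> (num s < num t)%N.
    move=> xs st; have [ct _] := numx _ (finx' _ (or_intror (le_lt xs st))).
    have [m [mt cm]] := covers_strict xs st ct.
    by have [_ /(_ _ cm) le_m] := numx _ (finx' _ xs); apply: leq_ltn_trans mt.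
  move=> s t xs xt e; case: (lt_total s t) => [st|[//|ts]].
    by have := mono _ _ xs st; rewrite e ltnn.
  by have := mono _ _ xt ts; rewrite e ltnn.
case: HW => _ [_ [_ [_ [/(_ x) cntx]]]]; apply.
have [e eP] := countable_setU cntx cnt; exists e => y _; apply: eP.
by case: (lt_total y x) => [|[->|]]; [left|right; left|right; right].
Qed.

Lemma limit_levels : exists (lim : W -> Prop) (lam : W -> W) (num : W -> nat),
  [/\ lim g /\ forall s, lim s -> le g s,
      forall s, exists t, lim t /\ lt s t,
      forall s, le g s -> lim (lam s) /\ le (lam s) s,
      forall s t n (e : nat -> W), lim s -> lim t -> lt s t ->
        exists x, [/\ le s x, lt x t & forall i, (i < n)%N -> e i <> x]
    & forall s t, le g s -> lt s t ->
        lt (lam s) (lam t) \/ lam s = lam t /\ (num s < num t)%N].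
Proof.
have /choice[lam lamP] : forall s, exists x,
    le g s -> [/\ limit x, le x s & fin x s].
  move=> s; have [gs|] := pselect (le g s); last by exists g.
  by have [x] := limit_below gs; exists x.
have /choice[num numP'] : forall s, exists n, fin (lam s) s ->
    covers (lam s) s n /\ forall m, covers (lam s) s m -> (n <= m)%N.
  by move=> s; apply: numP.
exists limit, lam, num; split.
- split; last by move=> s [].
  by split; [left|move=> x gx xg; case: (lt_irr (le_lt gx xg))].
- exact: limit_cofinal.
- by move=> s gs; case: (lamP _ gs).
- move=> s t n e [gs _] [_ tlim] st; apply: contrapT => no.
  apply: (tlim _ gs st); exists n, e => x sx xt; apply: contrapT => no'.
  by apply: no; exists x; split=> // i i_n ei; apply: no'; exists i.
- move=> s t gs st; have gt : le g t by right; apply: le_lt st.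
  have [ls lss fs] := lamP _ gs; have [ltt ltt' ft] := lamP _ gt.
  case: (lt_total (lam s) (lam t)) => [|[E|ts]]; first by left.
    right; split=> //; have [ct _] := numP' _ ft.
    have [|m [mt cm]] := covers_strict _ st ct; first by rewrite -E.
    have [_ /(_ m)] := numP' _ fs; rewrite E => /(_ cm) le_m.
    exact: leq_ltn_trans mt.
  (* If [lam t] were below [lam s], the finite interval [[lam t, t[] would contain [[lam t, lam s[],
     and [lam s] would not be a limit index. *)
  case: ls => _ /(_ (lam t)); case: ltt => gl _ /(_ gl ts); case.
  by apply: fin_sub ft _ _; [left|right; apply: le_lt st].
Qed.

End Order.

(** * Direct limits of cyclic modules *)

Lemma divf_cancel (F : fieldType) (x y z p k : F) : p != 0 -> k != 0 ->
  x * k * (y / (p * k)) - z / p = (y * x - z) / p.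
Proof. by move=> p0 k0; field; rewrite p0. Qed.

Section Modules.
Variable R : idomainType.

(** The quotient is carried by chosen representatives. The choice is applied to the class as a
    predicate, so by extensionality congruent elements get the same representative. *)
Lemma quotient_module (V : lmodType R) (N : V -> Prop) : is_submodule N ->
  exists (U : lmodType R) (p : V -> U),
    [/\ forall (a : R) x y, p (a *: x + y) = a *: p x + p y,
        forall u, exists x, p x = u & forall x, p x = 0 <-> N x].
Proof.
move=> [N0 ND NZ].
have NN x : N x -> N (- x) by rewrite -scaleN1r; apply: NZ.
have NB x y : N x -> N y -> N (x - y) by move=> Nx Ny; apply/ND/NN.
have /choice[ch chP] : forall P : V -> Prop, exists x, (exists y, P y) -> P x.
  move=> P; have [[x Px]|no] := pselect (exists y, P y); first by exists x.
  by exists 0.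
pose rep x := ch (fun y => N (y - x)).
have repP x : N (rep x - x).
  by apply: (chP (fun y => N (y - x))); exists x; rewrite subrr.
have repE x y : N (x - y) -> rep x = rep y.
  move=> Nxy; rewrite /rep; congr ch; apply/funext => z; apply/propext.
  split=> /= Nz.
    have -> : z - y = (z - x) + (x - y) by abelian_group.
    exact: ND.
  have -> : z - x = (z - y) - (x - y) by abelian_group.
  exact: NB.
have rep_rep x : rep (rep x) == rep x by apply/eqP/repE.
pose T := {x : V | rep x == x}.
pose p x : T := exist _ (rep x) (rep_rep x).
have pE x y : p x = p y <-> N (x - y).
  split=> [[E]|Nxy]; last by apply/val_inj/repE.
  have -> : x - y = (rep y - y) - (rep x - x).
    by rewrite E; abelian_group.
  exact: NB.
have p_val (u : T) : p (val u) = u by apply/val_inj/eqP/(valP u).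
have val_p x : N (val (p x) - x) by apply: repP.
pose add (u w : T) := p (val u + val w).
pose opp (u : T) := p (- val u).
pose scl a (u : T) := p (a *: val u).
have p_add x y : add (p x) (p y) = p (x + y).
  apply/pE.
  have -> : val (p x) + val (p y) - (x + y) = (val (p x) - x) + (val (p y) - y)
    by abelian_group.
  exact: ND.
have p_scl a x : scl a (p x) = p (a *: x).
  by apply/pE; rewrite -scalerBr; apply: NZ.
have addA : associative add.
  by move=> u v w; rewrite -(p_val u) -(p_val v) -(p_val w) !p_add addrA.
have addC : commutative add by move=> u v; rewrite /add addrC.
have add0 : left_id (p 0) add.
  by move=> u; rewrite -(p_val u) p_add add0r.
have addN : left_inverse (p 0) opp add.
  by move=> u; rewrite -{2}(p_val u) /opp p_add addNr.
pose zm := GRing.isZmodule.Build T addA addC add0 addN.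
pose Z : zmodType := HB.pack T zm.
have sclA a b (u : Z) : scl a (scl b u) = scl (a * b) u.
  by rewrite -(p_val u) !p_scl scalerA.
have scl1 : left_id 1 (scl : R -> Z -> Z).
  by move=> u; rewrite -(p_val u) p_scl scale1r.
have sclDr : right_distributive (scl : R -> Z -> Z) +%R.
  move=> a u w; rewrite -(p_val u) -(p_val w).
  by rewrite -[(_ + _ : Z)]/(add _ _) -[RHS]/(add _ _) p_add !p_scl p_add scalerDr.
have sclDl (u : Z) : {morph (scl^~ u : R -> Z) : a b / a + b >-> a + b}.
  move=> a b; rewrite -(p_val u) -[RHS]/(add _ _).
  by rewrite !p_scl p_add scalerDl.
pose lm := GRing.Zmodule_isLmodule.Build R Z sclA scl1 sclDr sclDl.
pose U : lmodType R := HB.pack (GRing.Zmodule.sort Z) lm.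
exists U, p; split.
- by move=> a x y; rewrite -[RHS]/(add (scl _ _) _) p_scl p_add.
- by move=> u; exists (val u).
- by move=> x; rewrite -[0]/(p 0) pE subr0.
Qed.

Lemma submodule_module (V : lmodType R) (P : V -> Prop) : is_submodule P ->
  exists (U : lmodType R) (i : U -> V),
    [/\ forall (a : R) x y, i (a *: x + y) = a *: i x + i y, injective i
      & forall x, P x <-> exists u, i u = x].
Proof.
move=> [P0 PD PZ].
have PN x : P x -> P (- x) by rewrite -scaleN1r; apply: PZ.
pose T := {x : V | `[< P x >]}.
have valT (u : T) : P (val u) by apply/asboolP/(valP u).
pose mk x (Px : P x) : T := exist _ x (introT (asboolP _) Px).
pose add (u w : T) := mk _ (PD _ _ (valT u) (valT w)).
pose opp (u : T) := mk _ (PN _ (valT u)).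
pose scl a (u : T) := mk _ (PZ a _ (valT u)).
have addA : associative add by move=> u v w; apply: val_inj; apply: addrA.
have addC : commutative add by move=> u v; apply: val_inj; apply: addrC.
have add0 : left_id (mk _ P0) add by move=> u; apply: val_inj; apply: add0r.
have addN : left_inverse (mk _ P0) opp add.
  by move=> u; apply: val_inj; apply: addNr.
pose zm := GRing.isZmodule.Build T addA addC add0 addN.
pose Z : zmodType := HB.pack T zm.
have sclA a b (u : Z) : scl a (scl b u) = scl (a * b) u.
  by apply: val_inj; apply: scalerA.
have scl1 : left_id 1 (scl : R -> Z -> Z).
  by move=> u; apply: val_inj; apply: scale1r.
have sclDr : right_distributive (scl : R -> Z -> Z) +%R.
  by move=> a u w; apply: val_inj; apply: scalerDr.
have sclDl (u : Z) : {morph (scl^~ u : R -> Z) : a b / a + b >-> a + b}.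
  by move=> a b; apply: val_inj; apply: scalerDl.
pose lm := GRing.Zmodule_isLmodule.Build R Z sclA scl1 sclDr sclDl.
pose U : lmodType R := HB.pack (GRing.Zmodule.sort Z) lm.
exists U, (fun u : U => val (u : T)); split=> [//|u w /val_inj //|x].
by split=> [Px|[u <-]]; [exists (mk _ Px)|apply: valT].
Qed.

Lemma frac_functions_module (L : Type) : exists (V : lmodType R)
    (ev : V -> L -> {fraction R}),
  [/\ forall (a : R) x y t, ev (a *: x + y) t = a%:F * ev x t + ev y t,
      forall t, ev 0 t = 0 & forall h, exists x, ev x = h].
Proof.
pose T := L -> {fraction R}.
pose add (x y : T) : T := fun t => x t + y t.
pose opp (x : T) : T := fun t => - x t.
pose scl (a : R) (x : T) : T := fun t => a%:F * x t.
have addA : associative add by move=> x y z; apply/funext => t; apply: addrA.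
have addC : commutative add by move=> x y; apply/funext => t; apply: addrC.
have add0 : left_id (fun=> 0) add by move=> x; apply/funext => t; apply: add0r.
have addN : left_inverse (fun=> 0) opp add.
  by move=> x; apply/funext => t; apply: addNr.
pose zm := GRing.isZmodule.Build T addA addC add0 addN.
pose Z : zmodType := HB.pack T (Choice.on T) zm.
have sclA a b (x : Z) : scl a (scl b x) = scl (a * b) x.
  by apply/funext => t; rewrite /scl rmorphM mulrA.
have scl1 : left_id 1 (scl : R -> Z -> Z).
  by move=> x; apply/funext => t; rewrite /scl rmorph1 mul1r.
have sclDr : right_distributive (scl : R -> Z -> Z) +%R.
  by move=> a x y; apply/funext => t; apply: mulrDr.
have sclDl (x : Z) : {morph (scl^~ x : R -> Z) : a b / a + b >-> a + b}.
  move=> a b; apply/funext => t; rewrite -[RHS]/(scl a x t + scl b x t) /scl.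
  by rewrite rmorphD mulrDl.
pose lm := GRing.Zmodule_isLmodule.Build R Z sclA scl1 sclDr sclDl.
pose V : lmodType R := HB.pack (GRing.Zmodule.sort Z) lm.
by exists V, (fun x : V => x : T); split=> // h; exists h.
Qed.

Lemma inRD (x y : {fraction R}) : inR x -> inR y -> inR (x + y).
Proof. by move=> [a ->] [b ->]; exists (a + b); rewrite rmorphD. Qed.

Lemma inRM (a : R) (x : {fraction R}) : inR x -> inR (a%:F * x).
Proof. by move=> [b ->]; exists (a * b); rewrite rmorphM. Qed.

Lemma inRN (x : {fraction R}) : inR x -> inR (- x).
Proof. by move=> [b ->]; exists (- b); rewrite rmorphN. Qed.

Lemma tofrac_inj : injective (@FracField.tofrac R).
Proof. by move=> a b /eqP; rewrite tofrac_eq => /eqP. Qed.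

Lemma inR_div (a b : R) : b != 0 -> inR (a%:F / b%:F) <-> dvd b a.
Proof.
move=> b0; have b0' : b%:F != 0 by rewrite tofrac_eq0.
split=> [[t]|[t ->]]; last by exists t; rewrite rmorphM /= mulrC mulKf.
move/(congr1 ( *%R^~ b%:F)); rewrite divfK // -rmorphM => /tofrac_inj ->.
by exists t; rewrite mulrC.
Qed.

(* The direct limit of the modules [R / p_s R] along the maps
   [1 |-> c_ts p_t / p_s], realized inside the germs at infinity of functions
   [L -> Q/R] by sending the generator of level [s] to [t |-> c_ts / p_s]. *)
Lemma twisted_limit (L : Type) (lt : L -> L -> Prop) (p : L -> R)
    (c : L -> L -> R) (s0 : L) :
  (forall s t u, lt s t -> lt t u -> lt s u) ->
  (forall s t, lt s t \/ s = t \/ lt t s) -> (forall s, exists t, lt s t) ->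
  (forall s, p s != 0) -> (forall s t, lt s t -> dvd (p s) (p t)) ->
  (forall s t, c s t \is a GRing.unit) ->
  (forall s t u, lt s t -> lt t u -> dvd (p s) (c u t * c t s - c u s)) ->
  exists (U : lmodType R) (b : L -> U),
    [/\ forall u, exists s a, u = a *: b s,
        forall s t k, lt s t -> p t = p s * k -> b s = (c t s * k) *: b t
      & forall s a, a *: b s = 0 <-> dvd (p s) a].
Proof.
move=> lt_trans lt_total lt_ub p0 pdvd cu ccoh.
have pF s : (p s)%:F != 0 by rewrite tofrac_eq0.
have [V [ev [evL ev0 evS]]] := frac_functions_module L.
have evZ (a : R) x t : ev (a *: x) t = a%:F * ev x t.
  by rewrite -[a *: x]addr0 evL ev0 addr0.
have evD x y t : ev (x + y) t = ev x t + ev y t.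
  by rewrite -[x]scale1r evL scale1r rmorph1 mul1r.
(* Functions with values eventually in [R]: the quotient by them consists of germs of functions to
   Q/R. *)
pose null (x : V) := exists s, forall t, lt s t -> inR (ev x t).
have above s t : exists u, lt s u /\ lt t u.
  case: (lt_total s t) => [st|[->|ts]].
  - by have [u tu] := lt_ub t; exists u; split=> //; apply: lt_trans tu.
  - by have [u tu] := lt_ub t; exists u.
  - by have [u su] := lt_ub s; exists u; split=> //; apply: lt_trans su.
have nullP : is_submodule null.
  split.
  - by exists s0 => t _; rewrite ev0; exists 0; rewrite rmorph0.
  - move=> x y [s xs] [t yt]; have [u [su tu]] := above s t.
    exists u => w uw; rewrite evD.
    by apply: inRD; [apply: xs; apply: lt_trans uw|apply: yt; apply: lt_trans uw].
  - by move=> a x [s xs]; exists s => t /xs; rewrite evZ; apply: inRM.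
have [U1 [pi [piL piS piN]]] := quotient_module nullP.
have /choice[b0 b0E] : forall s, exists x, ev x = fun t => (c t s)%:F / (p s)%:F.
  by move=> s; apply: evS.
pose b1 s := pi (b0 s).
have piZ a x : pi (a *: x) = a *: pi x.
  have pi0 : pi 0 = 0 by apply/piN; case: nullP.
  by rewrite -[a *: x]addr0 piL pi0 addr0.
have b1E s t k : lt s t -> p t = p s * k -> b1 s = (c t s * k) *: b1 t.
  move=> st pk; apply/esym/eqP; rewrite -subr_eq0; apply/eqP.
  rewrite -[- b1 s]scaleN1r /b1 -[-1 *: _]piZ -piL; apply/piN; exists t => u tu.
  rewrite evL evZ !b0E rmorphN rmorph1 mulN1r.
  have k0 : k%:F != 0.
    by have := pF t; rewrite pk rmorphM mulf_eq0 negb_or => /andP[].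
  (* At a level [u] above [t] the two generators differ by the cocycle defect over [p s], which lies
     in [R]. *)
  have -> : (c t s * k)%:F * ((c u t)%:F / (p t)%:F) - (c u s)%:F / (p s)%:F =
      (c u t * c t s - c u s)%:F / (p s)%:F.
    by rewrite pk !(rmorphM, rmorphB) /=; apply: divf_cancel.
  by apply/inR_div => //; apply: ccoh.
have b1_ann s a : a *: b1 s = 0 <-> dvd (p s) a.
  rewrite /b1 -piZ piN; split=> [[t tP]|pa].
    have [u [tu _]] := above t s; have := tP _ tu.
    rewrite evZ b0E mulrA -rmorphM => /(inR_div _ (p0 s)).
    by rewrite mulrC; apply: dvd_unit_mull.
  exists s => t _; rewrite evZ b0E mulrA -rmorphM; apply/inR_div => //.
  exact: dvd_mulr.
pose P u := exists s a, u = a *: b1 s.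
have lift s t : lt s t -> exists k, b1 s = k *: b1 t.
  by move=> st; have [k pk] := pdvd _ _ st; exists (c t s * k); apply: b1E.
have PP : is_submodule P.
  split.
  - by exists s0, 0; rewrite scale0r.
  - move=> x y [s [a ->]] [t [a' ->]]; have [u [su tu]] := above s t.
    have [k ->] := lift _ _ su; have [k' ->] := lift _ _ tu.
    by exists u, (a * k + a' * k'); rewrite scalerDl !scalerA.
  - by move=> a x [s [a' ->]]; exists s, (a * a'); rewrite scalerA.
have [U [i [iL iI iP]]] := submodule_module PP.
have i0 : i 0 = 0.
  by apply: (addIr (i 0)); rewrite -{1}[i 0]scale1r -iL scale1r addr0 add0r.
have iZ a x : i (a *: x) = a *: i x by rewrite -[a *: x]addr0 iL i0 addr0.
have /choice[b bE] : forall s, exists u, i u = b1 s.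
  by move=> s; apply/iP; exists s, 1; rewrite scale1r.
exists U, b; split.
- move=> u; have [s [a E]] : P (i u) by apply/iP; exists u.
  by exists s, a; apply: iI; rewrite iZ bE.
- by move=> s t k st pk; apply: iI; rewrite iZ !bE; apply: b1E.
- move=> s a; rewrite -b1_ann -bE -iZ; split=> [->//|E].
  by apply: iI; rewrite E i0.
Qed.

End Modules.

(** * The cocycle of units *)

(** The weight of [b] exceeds any finite sum of weights beyond [b], so whatever [P] gains later
    cannot make up for its missing [b]. In [main], the gap [hpow (m + b)] is halved as each new term
    is paid for. *)
Lemma subset_weight_lt (P Q : pred nat) (b n : nat) :
  {subset P <= Q} -> Q b -> ~~ P b ->
  \sum_(0 <= k < n | P k) hpow k < \sum_(0 <= k < b.+1 | Q k) hpow k.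
Proof.
move=> PQ Qb Pb; pose S (T : pred nat) m := \sum_(0 <= k < m | T k) hpow k.
have SS T m : S T m.+1 = S T m + (if T m then hpow m else 0).
  by rewrite /S big_mkcond big_nat_recr //= -big_mkcond.
have S_le T m : S T m <= S T m.+1.
  by rewrite SS; case: ifP => _; have := hpow_gt0 m; lra.
have SPQ m : S P m <= S Q m.
  elim: m => [|m IH]; first by rewrite /S !big_geq.
  rewrite !SS; case: ifP => [/PQ|_]; last by case: ifP => _; have := hpow_gt0 m; lra.
  by rewrite -topredE /= => ->; lra.
have S_mono T m m' : (m <= m')%N -> S T m <= S T m'.
  move=> /subnK <-; elim: (m' - m)%N => [|k IH] //.
  by rewrite addSn; apply: le_trans IH (S_le _ _).
have main m : S P (m + b.+1)%N + hpow (m + b) <= S Q b.+1.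
  elim: m => [|m IH]; first by rewrite !add0n !SS Qb (negPf Pb); have := SPQ b; lra.
  have -> : (m.+1 + b)%N = (m + b).+1 by [].
  rewrite addSn SS hpowS addnS; move: IH; rewrite addnS.
  by case: ifP => _; rewrite ?hpowS; have := hpow_gt0 (m + b); lra.
have := main n; have := hpow_gt0 (n + b); have := S_mono P _ _ (leq_addr b.+1 n).
by rewrite -/(S P n) -/(S Q b.+1); lra.
Qed.

Section SpecializedCocycle.
Variables (R : idomainType) (W : Type) (lt : W -> W -> Prop) (r : W -> R).
Hypothesis HR : valuation_domain R.
Hypothesis HW : omega1_order lt.
Hypothesis r_dvd : forall t s, lt t s -> dvd (r t) (r s) /\ ~ dvd (r s) (r t).
Variables (g0 g : W) (lim : W -> Prop).
Hypothesis g0g : lt g0 g.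
Hypothesis lim_ge : forall s, lim s -> g = s \/ lt g s.
Hypothesis r_count : forall s, lt g0 s -> exists h : nat -> R,
  forall x, dvd (r g0) x -> exists n, dvd (r s) (x - h n).
Hypothesis lim_inf : forall s t n (e : nat -> W), lim s -> lim t -> lt s t ->
  exists x, [/\ s = x \/ lt s x, lt x t & forall i, (i < n)%N -> e i <> x].

Let L := {s : W | lim s}.
Let ltL (s t : L) := lt (sval s) (sval t).

Let lt_trans x y z : lt x y -> lt y z -> lt x z.
Proof. by case: HW => _ [+ _]; apply. Qed.

Let dvd_le s t x : s = t \/ lt s t -> dvd (r t) x -> dvd (r s) x.
Proof. by move=> [->//|/r_dvd[st _]]; apply: dvd_trans. Qed.

Let g_le (s : L) : g = sval s \/ lt g (sval s).
Proof. by apply: lim_ge; apply: (svalP s). Qed.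

Let g0_lt (s : L) : lt g0 (sval s).
Proof. by case: (g_le s) => [<-//|]; apply: lt_trans. Qed.

(** This is why [g] is taken strictly above [g0]: [r g] has the proper divisor [r g0]. *)
Lemma r_nonunit : ~ dvd (r g) 1.
Proof. by move=> g1; case: (r_dvd g0g) => _; case; rewrite -[r g0]mul1r; apply: dvd_mulr. Qed.

(** Instance of [coherent_specialization] for the group [1 + r_g R] and its subgroups [1 + r_s R],
    extended to all units through the representatives [rep]. *)
Lemma specialized_cocycle : exists (c : L -> L -> R) (f : L -> R -> rat),
  [/\ forall s t, c s t \is a GRing.unit,
      forall s t u, ltL s t -> ltL t u -> dvd (r (sval s)) (c u t * c t s - c u s),
      forall s x y, x \is a GRing.unit -> dvd (r (sval s)) (x - y) -> f s x = f s y
    & forall s t x, ltL s t -> x \is a GRing.unit -> f s (c t s * x) < f t x].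
Proof.
have [G [j [j0 jD jg jS]]] := principal_unit_group HR r_nonunit.
have ju x : j x \is a GRing.unit by apply: (unit_congr HR r_nonunit (unitr1 R)).
pose K (s : L) x := dvd (r (sval s)) (j x - 1).
have KE s x y : K s (x - y) <-> dvd (r (sval s)) (j x - j y).
  have E : j x - j y = j y * (j (x - y) - 1).
    by rewrite mulrBr mulr1 -jD [y + _]addrC subrK.
  by rewrite E /K; split; [apply: dvd_mull|apply: dvd_unit_mull].
have ltL_wf : well_founded ltL.
  case: HW => _ [_ [_ [wf _]]] x; have [w] := ex_intro (fun w => sval x = w) _ erefl.
  elim/(well_founded_ind wf): w x => w IH x xw; constructor => y.
  by rewrite /ltL xw => yw; apply: IH yw _ _.
have ltL_total (s t : L) : ltL s t \/ s = t \/ ltL t s.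
  by apply: sig_total; case: HW => _ [_ []].
have ltL_count d : countable_set (fun x => ltL x d).
  case: HW => _ [_ [_ [_ [/(_ (sval d))[e eP] _]]]].
  exists (fun n => if e n is Some w then
    (if pselect (lim w) is left lw then Some (exist _ w lw) else None) else None).
  move=> [x lx] /eP[n en]; exists n; rewrite en; case: pselect => // lx'.
  by congr (Some (exist _ _ _)); apply: Prop_irrelevance.
have K0 s : K s 0 by rewrite /K j0 subrr; apply: dvd0.
have KB s x y : K s x -> K s y -> K s (x - y).
  move=> Kx Ky; apply/KE; have -> : j x - j y = (j x - 1) - (j y - 1) by ring.
  exact: dvdB.
have Klt s t x : ltL s t -> K t x -> K s x by move=> st; apply: dvd_le; right.
have Kcount s : exists v : nat -> G, forall x, exists n, K s (x - v n).
  have [h hP] := r_count (g0_lt s).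
  have /choice[v vP] : forall n, exists y, forall x,
      dvd (r (sval s)) (j x - 1 - h n) -> dvd (r (sval s)) (j x - j y).
    move=> n; have [[y yP]|no] := pselect (exists y, dvd (r (sval s)) (j y - 1 - h n)).
      exists y => x xP; have -> : j x - j y = (j x - 1 - h n) - (j y - 1 - h n) by ring.
      exact: dvdB.
    by exists 0 => x xP; case: no; exists x.
  exists v => x; have [|n nP] := hP (j x - 1).
    by apply: dvd_le (jg x); right.
  by exists n; apply/KE/vP.
(* The elements [1 + r x] with [x] in the infinite interval [[s, t[] lie in [K s] and are pairwise
   incongruent modulo [r t]. Each member of [B] is congruent to at most one of them, recorded by
   [e]. *)
have Kinf s t (B : seq G) : ltL s t ->
    exists k, K s k /\ forall b, b \in B -> ~ K t (k - b).
  move=> st; apply: contrapT => no.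
  pose near x i := [/\ sval s = x \/ lt (sval s) x, lt x (sval t)
    & dvd (r (sval t)) (1 + r x - j (B`_i))].
  have /choice[e eP] : forall i, exists x, forall y, near y i -> near x i.
    move=> i; have [[x xP]|no'] := pselect (exists x, near x i); first by exists x.
    by exists g => y yP; case: no'; exists y.
  have [x [sx xt xe]] := lim_inf (size B) e (svalP s) (svalP t) st.
  have gx : g = x \/ lt g x.
    by case: sx (g_le s) => [<-//|sx] [->|gs]; right=> //; apply: lt_trans sx.
  have [k kE] : exists k, j k = 1 + r x.
    by apply: jS; rewrite addrC addKr; apply: (dvd_le gx); apply: dvd_refl.
  have Ksk : K s k.
    by rewrite /K kE addrC addKr; apply: (dvd_le sx); apply: dvd_refl.
  have [b [bB Kb]] : exists b, b \in B /\ K t (k - b).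
    apply: contrapT => no'; apply: no; exists k; split=> // b bB Kb.
    by apply: no'; exists b.
  move: bB; rewrite -index_mem => ib; apply: (xe _ ib).
  have nx : near x (index b B).
    by split=> //; rewrite nth_index -?index_mem // -kE; apply/KE.
  have [se et ne] := eP _ _ nx; set x' := e _ in se et ne *.
  have rt : dvd (r (sval t)) (r x - r x').
    have -> : r x - r x' = (1 + r x - j (B`_(index b B))) - (1 + r x' - j (B`_(index b B)))
      by ring.
    by apply: dvdB => //; case: nx.
  have incomp y z : lt y (sval t) -> lt z y -> dvd (r (sval t)) (r z - r y) -> False.
    move=> yt zy zt; case: (r_dvd zy) => _; apply.
    rewrite -[r z](subrK (r y)); apply: dvdD (dvd_refl _).
    by apply: dvd_le zt; right.
  case: HW => _ [_ [/(_ x' x) + _]] => -[h|[//|h]].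
    by case: (incomp _ _ xt h); rewrite -opprB; apply: dvdN.
  by case: (incomp _ _ et h).
have ltL_trans (x y z : L) : ltL x y -> ltL y z -> ltL x z by apply: lt_trans.
have ltL_irr (x : L) : ~ ltL x x by case: HW => + _; apply.
have [c [f [c_coh f_congr f_mono]]] :=
  coherent_specialization ltL_trans ltL_irr ltL_total ltL_wf ltL_count K0 KB Klt Kcount Kinf.
have /choice[ch chP] : forall P : R -> Prop, exists x, (exists y, P y) -> P x.
  move=> P; have [[x Px]|no] := pselect (exists y, P y); first by exists x.
  by exists 0.
(* [rep] selects a unit in each residue class of units modulo [r g]; dividing by
   it brings every unit into [1 + r_g R]. *)
pose rep x := ch (fun y => y \is a GRing.unit /\ dvd (r g) (y - x)).
have repP x : x \is a GRing.unit -> rep x \is a GRing.unit /\ dvd (r g) (rep x - x).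
  move=> ux; apply: (chP (fun y => y \is a GRing.unit /\ dvd (r g) (y - x))).
  by exists x; rewrite subrr; split=> //; apply: dvd0.
have repE x y : dvd (r g) (x - y) -> rep x = rep y.
  move=> xy; congr ch; apply/funext => z; apply/propext.
  split=> -[uz zP]; split=> //.
    by rewrite -(subrKA x); apply: dvdD.
  by rewrite -(subrKA y) -[y - x]opprB; apply: dvdB.
have /choice[jinv jinvP] : forall x, exists k, dvd (r g) (x - 1) -> j k = x.
  move=> x; have [/jS[k ?]|] := pselect (dvd (r g) (x - 1)); first by exists k.
  by exists 0.
have norm1 x : x \is a GRing.unit -> j (jinv (x / rep x)) = x / rep x.
  move=> ux; have [ur rx] := repP _ ux; apply: jinvP.
  have -> : x / rep x - 1 = - (rep x - x) / rep x by rewrite opprB mulrBl divrr.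
  by apply: dvd_mulr; apply: dvdN.
exists (fun t s => j (c t s)), (fun s x => f s (jinv (x / rep x))); split=> //.
- by move=> s t u st tu; rewrite -jD; apply/KE; apply: c_coh.
- move=> s x y ux xy; have gxy := dvd_le (g_le s) xy.
  have uy : y \is a GRing.unit.
    by apply: (unit_congr HR r_nonunit ux); rewrite -opprB; apply: dvdN.
  apply: f_congr; apply/KE; rewrite !norm1 // (repE _ _ gxy) -mulrBl.
  exact: dvd_mulr.
(* Since [j k] is 1 modulo [r g], multiplying by it keeps [rep x]; on normalized units it becomes
   addition of [k] in [G]. *)
- move=> s t x st ux; set k := c t s.
  have rE : rep (j k * x) = rep x.
    by apply: repE; rewrite -{2}[x]mul1r -mulrBl; apply: dvd_mulr.
  have := f_mono s t (jinv (x / rep x)) st; congr (_ < _); apply: f_congr.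
  apply/KE; rewrite jD !norm1 ?unitrM ?ju ?ux // rE mulrA subrr; exact: dvd0.
Qed.

End SpecializedCocycle.

(** * The module *)

Lemma subf_mul_div (F : fieldType) (x y p c k : F) : p != 0 ->
  x - c * k * y = (x * p - c * (y * (p * k))) / p.
Proof. by move=> p0; field. Qed.

Section Tower.
Variables (R : idomainType) (W : Type) (lt : W -> W -> Prop) (r : W -> R).
Hypothesis HR : valuation_domain R.
Hypothesis HW : omega1_order lt.
Hypothesis r0 : forall s, r s != 0.
Hypothesis r_dvd : forall t s, lt t s -> dvd (r t) (r s) /\ ~ dvd (r s) (r t).
Variable lim : W -> Prop.
Hypothesis lim_cofinal : forall s, exists t, lim t /\ lt s t.
Hypothesis r_lim : forall s, lim s -> ~ dvd (r s) 1.

Let L := {s : W | lim s}.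

Variable c : L -> L -> R.
Hypothesis c_unit : forall s t, c s t \is a GRing.unit.
Variables (U : lmodType R) (b : L -> U).
Hypothesis b_gen : forall u, exists s a, u = a *: b s.
Hypothesis b_lift : forall s t k, lt (sval s) (sval t) ->
  r (sval t) = r (sval s) * k -> b s = (c t s * k) *: b t.
Hypothesis b_ann : forall s, ann_eq (b s) (r (sval s)).

Let le s t := s = t \/ lt s t.

Let lt_trans x y z : lt x y -> lt y z -> lt x z.
Proof. by case: HW => _ [+ _]; apply. Qed.
Let lt_total x y : lt x y \/ x = y \/ lt y x.
Proof. by case: HW => _ [_ [+ _]]; apply. Qed.
Let rF s : (r s)%:F != 0.
Proof. by rewrite tofrac_eq0. Qed.

Let above s t : exists u : L, lt s (sval u) /\ lt t (sval u).
Proof.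
case: (lt_total s t) => [st|[->|ts]].
- by have [u [lu tu]] := lim_cofinal t; exists (exist _ u lu); split=> //; apply: lt_trans tu.
- by have [u [lu tu]] := lim_cofinal t; exists (exist _ u lu).
- by have [u [lu su]] := lim_cofinal s; exists (exist _ u lu); split=> //; apply: lt_trans su.
Qed.

Let lift s t : lt (sval s) (sval t) -> exists k, b s = k *: b t.
Proof.
by move=> st; have [[k rk] _] := r_dvd st; exists (c t s * k); apply: b_lift.
Qed.

Let gen_above u w : exists (s : L) a, lt w (sval s) /\ u = a *: b s.
Proof.
have [s [a ->]] := b_gen u; have [t [wt st]] := above w (sval s).
by have [k ->] := lift st; exists t, (a * k); rewrite scalerA.
Qed.

Let gen2 u v : exists (s : L) a a', u = a *: b s /\ v = a' *: b s.
Proof.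
have [s [a ->]] := b_gen u; have [t [a' [st ->]]] := gen_above v (sval s).
by have [k ->] := lift st; exists t, (a * k), a'; rewrite scalerA.
Qed.

(** Two elements are multiples of a common [b s], and their coefficients are comparable for
    divisibility. *)
Lemma tower_uniserial : uniserial U.
Proof.
move=> A B [_ _ AZ] [_ _ BZ].
have [AB|nAB] := pselect (forall x, A x -> B x); [by left|right=> y By].
move: nAB => /existsNP[x /not_implyP[Ax nBx]].
have [s [a [a' [xE yE]]]] := gen2 x y.
case: (dvd_total HR a a') => -[k kE].
  by rewrite yE kE mulrC -scalerA -xE; apply: AZ.
by case: nBx; rewrite xE kE mulrC -scalerA -yE; apply: BZ.
Qed.

Let b_neq0 s : b s != 0.
Proof.
apply/eqP => b0; apply: (r_lim (svalP s)); apply/b_ann.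
by rewrite b0 scaler0.
Qed.

(** With [p = r s0], the annihilator of [b s0] is pR and its D is pJ, so multiplication by [p] is
    the required isomorphism. *)
Lemma tower_has_type (J : {fraction R} -> Prop) (s0 : L) :
  (forall x, J x <-> exists s, in_invR (r s) x) -> has_type U J.
Proof.
move=> JP; exists (b s0); split=> //; set p := r (sval s0).
have p0 : p%:F != 0 := rF _.
exists (fun x => p%:F * x); split.
- move=> x /JP[s [t xt]]; have [u [su s0u]] := above s (sval s0).
  have [[m mE] _] := r_dvd su; have [[k kE] _] := r_dvd s0u.
  exists k; split.
  + by apply: contraNneq (r0 (sval u)) => k0; rewrite kE k0 mulr0.
  + by exists (c u s0 *: b u); rewrite scalerA mulrC; apply: b_lift.
  + exists (t * m); rewrite rmorphM /= -xt -[RHS]mulrA -rmorphM -mE kE rmorphM /=.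
    by rewrite -/p mulrCA mulrA.
- move=> x y s t _ _; exists 0; rewrite ?scale0r // rmorph0.
  by apply/eqP; rewrite subr_eq0 mulrDr !(mulrCA p%:F).
- move=> x _; split=> [[s /b_ann[t ->]]|[t ->]].
    by rewrite rmorphM /= => /(mulfI p0) ->; exists t.
  by exists (p * t); [apply/b_ann; exists t|rewrite rmorphM].
- move=> y [q [q0 [u uE] [t tE]]]; exists (p%:F^-1 * y); last first.
    by exists 0; rewrite ?scale0r // mulVKf // subrr rmorph0.
  have [w [a [s0w uw]]] := gen_above u (sval s0).
  have [[k kE] _] := r_dvd s0w.
  have : (q * a - c w s0 * k) *: b w = 0.
    by rewrite scalerBl -scalerA -uw -uE -b_lift // subrr.
  (* Comparing coefficients of [b w] gives [q * a = k * e], with [e] a unit because it is congruent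
     to one modulo the nonunit [p]. Hence [q] divides [k]. *)
  move=> /b_ann[m mE]; pose e := c w s0 + p * m.
  have ue : e \is a GRing.unit.
    apply: (unit_congr HR (r_lim (svalP s0)) (c_unit w s0)).
    by exists m; rewrite /e addrC addKr.
  have kq : k = q * (a / e).
    apply: (mulIr ue); rewrite -mulrA divrK // -[q * a](subrK (c w s0 * k)) mE kE.
    by rewrite -/p /e; ring.
  apply/JP; exists (sval w), (t * (a / e)).
  by rewrite kE -/p !rmorphM /= -tE kq !rmorphM /= mulrA [_^-1 * y]mulrC mulfVK // !mulrA.
Qed.

(** For an arbitrary index [s], the multiple of [b t] by [r t / r s], with [t] a limit index above
    [s], has annihilator generated by [r s]. *)
Lemma tower_ann_ex : exists a : W -> U, forall s, ann_eq (a s) (r s).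
Proof.
suff /choice[a aP] : forall s, exists x : U, ann_eq x (r s) by exists a.
move=> s.
have [t [st _]] := above s s; have [[k kE] _] := r_dvd st.
have k0 : k != 0 by apply: contraNneq (r0 (sval t)) => k0; rewrite kE k0 mulr0.
exists (k *: b t) => x; rewrite scalerA; split.
  move=> /b_ann[y]; rewrite kE -mulrA [k * y]mulrC mulrA => /(mulIf k0) ->.
  by exists y.
by move=> [y ->]; apply/b_ann; exists y; rewrite kE mulrAC.
Qed.

(** If instead [y = k x], the annihilators force [s = t], and comparing [k] with [r s] shows that
    [k] is invertible or both elements vanish. *)
Let ann_in_cyc (x y : U) s t : ann_eq x (r s) -> ann_eq y (r t) -> le s t -> in_cyc y x.
Proof.
move=> xs yt st; have [u [a [a' [xE yE]]]] := gen2 x y.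
case: (dvd_total HR a' a) => -[k kE].
  by exists k; rewrite xE kE mulrC -scalerA -yE.
have yx : y = k *: x by rewrite xE yE kE scalerA mulrC.
have ts : dvd (r t) (r s).
  by apply/yt; rewrite yx scalerA mulrC -scalerA; have /xs -> := dvd_refl (r s); rewrite scaler0.
have E : s = t by case: st => // /r_dvd[].
subst t; case: (dvd_total HR (r s) k) => [sk|[m mE]].
  have y0 : y = 0 by rewrite yx; apply/xs.
  have x0 : x = 0.
    have s1 : dvd (r s) 1 by apply/yt; rewrite y0 scaler0.
    by rewrite -[x]scale1r; apply/xs.
  by exists 0; rewrite x0 scale0r.
have [n nE] : dvd (r s) m.
  by apply/yt; rewrite yx scalerA mulrC -mE; apply/xs/dvd_refl.
exists n; rewrite yx scalerA -[LHS]scale1r; congr (_ *: _).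
by apply: (mulfI (r0 s)); rewrite mulr1 [LHS]mE nE; ring.
Qed.

Variable a : W -> U.
Hypothesis a_ann : forall s, ann_eq (a s) (r s).

Let b_in_a (l : L) s : le (sval l) s -> in_cyc (a s) (b l).
Proof. exact: ann_in_cyc. Qed.

(** An isomorphism preserves annihilators: the image of [b l] is [u / r l] with annihilator exactly
    generated by [r l], which forces [u] to be a unit. *)
Let iso_coef s psi (l : L) : iso_rep (a s) (r s) psi -> le (sval l) s ->
  exists u, u \is a GRing.unit /\ psi (b l) * (r (sval l))%:F = u%:F.
Proof.
move=> [_ lin ker _] ls; have bl := b_in_a ls; set p := r (sval l).
have p0 : p%:F != 0 := rF _.
have linZ (x : R) : inR (psi (x *: b l) - x%:F * psi (b l)).
  by have := lin _ _ x 0 bl bl; rewrite scale0r addr0 rmorph0 mul0r addr0.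
have kerZ (x : R) : x *: b l = 0 <-> inR (x%:F * psi (b l)).
  have xc : in_cyc (a s) (x *: b l).
    by have [k ->] := bl; exists (x * k); rewrite scalerA.
  rewrite -(ker _ xc); split=> h.
    by rewrite -[_ * _](subKr (psi (x *: b l))); apply: inRD => //; apply: inRN.
  by rewrite -[psi _](subrK (x%:F * psi (b l))); apply: inRD.
have /kerZ[u uE] : p *: b l = 0 by apply/b_ann/dvd_refl.
exists u; split; last by rewrite mulrC.
have psiE : psi (b l) = u%:F / p%:F by rewrite -uE mulrAC divff // mul1r.
have kerP x : x *: b l = 0 <-> dvd p (x * u).
  by rewrite kerZ psiE mulrA -rmorphM; apply: inR_div; apply: r0.
apply/dvd1P; case: (dvd_total HR p u) => [pu|[m mE]].
  case: (r_lim (svalP l)); apply/b_ann/kerP; exact: dvd_mull.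
have [n nE] : dvd p m.
  by apply/b_ann/kerP; rewrite mulrC -mE; apply: dvd_refl.
exists n; apply: (mulfI (r0 (sval l))).
by rewrite -/p mulr1 [LHS]mE nE; ring.
Qed.

(** * Colours and the special family *)

Variables (g : W) (lam : W -> W) (num : W -> nat) (f : L -> R -> rat).
Hypothesis lamP : forall s, le g s -> lim (lam s) /\ le (lam s) s.
Hypothesis lam_num : forall s t, le g s -> lt s t ->
  lt (lam s) (lam t) \/ lam s = lam t /\ (num s < num t)%N.
Hypothesis f_congr : forall s x y, x \is a GRing.unit ->
  dvd (r (sval s)) (x - y) -> f s x = f s y.
Hypothesis f_mono : forall s t x, lt (sval s) (sval t) -> x \is a GRing.unit ->
  f s (c t s * x) < f t x.

Lemma tower_special : exists h, special_family lt r a h.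
Proof.
have [l0 _] := above g g.
have /choice[lamL lamLP] : forall s, exists l : L, le g s -> sval l = lam s.
  move=> s; have [gs|] := pselect (le g s); last by exists l0.
  by have [ll _] := lamP gs; exists (exist _ _ ll).
have lamL_le s : le g s -> le (sval (lamL s)) s.
  by move=> gs; rewrite lamLP //; case: (lamP gs).
have [idx idx_inj] : exists idx : W -> nat, forall s t, lt s g -> lt t g ->
    idx s = idx t -> s = t.
  case: HW => _ [_ [_ [_ [/(_ g)[e eP] _]]]].
  have /choice[idx idxP] : forall s, exists n, lt s g -> e n = Some s.
    move=> s; have [/eP[n en]|] := pselect (lt s g); first by exists n.
    by exists 0%N.
  by exists idx => s t /idxP + /idxP + E; rewrite E => -> [].
have /choice[co coP] : forall q : L * (U -> {fraction R}), exists u,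
    forall u', q.2 (b q.1) * (r (sval q.1))%:F = u'%:F -> u = u'.
  move=> q; have [[u uE]|no] :=
    pselect (exists u, q.2 (b q.1) * (r (sval q.1))%:F = u%:F).
    by exists u => u'; rewrite uE => /tofrac_inj.
  by exists 0 => u' uE; case: no; exists u'.
have co_iso s psi (l : L) : iso_rep (a s) (r s) psi -> le (sval l) s ->
    co (l, psi) \is a GRing.unit /\ psi (b l) * (r (sval l))%:F = (co (l, psi))%:F.
  by move=> ip ls; have [u [uu uE]] := iso_coef ip ls; rewrite (coP (l, psi) u uE).
have glt s : ~ lt s g -> le g s by case: (lt_total g s) => [|[]]; [right|left|].
(* Colour of the restriction of [psi] to level [s], coded as a natural number. The countably many
   levels below [g] serve as their own colours. *)
pose col s psi : nat := pickle (if `[< lt s g >] then inl (idx s)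
  else inr (f (lamL s) (co (lamL s, psi)), num s) : (nat + (rat * nat))%type).
have col_congr t psi psi' s s' : iso_rep (a s) (r s) psi -> iso_rep (a s') (r s') psi' ->
    le t s -> le t s' -> (forall l : L, le (sval l) t -> inR (psi (b l) - psi' (b l))) ->
    col t psi = col t psi'.
  move=> ip ip' ts ts' E; rewrite /col; congr pickle.
  case: asboolP => // /glt gt; congr (inr (_, _)); set l := lamL t.
  have lt_ : le (sval l) t by apply: lamL_le.
  have le_tr x : le t x -> le (sval l) x.
    by move=> [<-//|tx]; right; case: lt_ => [->//|lt_]; apply: lt_trans tx.
  have [u1 e1] := co_iso _ _ l ip (le_tr _ ts).
  have [_ e2] := co_iso _ _ l ip' (le_tr _ ts').
  apply: f_congr => //; apply/inR_div => //.
  by rewrite rmorphB /= -e1 -e2 -mulrBl mulfK //; apply: E.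
(* Injectivity on chains: above [g], either [lam] grows and the value of [f] with it, or [lam] is
   unchanged and [num] grows. *)
have col_neq s t psi : iso_rep (a t) (r t) psi -> lt s t -> col s psi <> col t psi.
  move=> ip st /(pcan_inj pickleK).
  case: asboolP => sg; case: asboolP => tg //.
    by move=> [/(idx_inj _ _ sg tg) E]; case: HW => /(_ t) + _; apply; rewrite -{1}E.
  move=> [fE nE]; have gs := glt _ sg; have gt := glt _ tg.
  have [ll|[_]] := lam_num gs st; last by rewrite nE ltnn.
  move: fE; set l := lamL s; set m := lamL t.
  have lm : lt (sval l) (sval m) by rewrite /l /m !lamLP.
  have mt : le (sval m) t by apply: lamL_le.
  have lt_ : le (sval l) t by right; case: mt => [<-//|]; apply: lt_trans lm.
  have [ul el] := co_iso _ _ l ip lt_; have [um em] := co_iso _ _ m ip mt.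
  (* By linearity of [psi], the coefficient at level [l] is [c m l] times the one at level [m],
     modulo [r l]. *)
  rewrite (@f_congr l _ (c m l * co (m, psi))) //.
    by move=> E; have := f_mono lm um; rewrite E ltxx.
  have [[k kE] _] := r_dvd lm; have bE := b_lift lm kE.
  apply/inR_div => //; rewrite rmorphB rmorphM /= -el -em kE rmorphM /=.
  have bm := b_in_a mt.
  case: ip => _ /(_ _ _ (c m l * k) 0 bm bm) + _ _.
  rewrite scale0r addr0 -bE rmorph0 mul0r addr0 rmorphM /=.
  set P := psi (b l); set Q := psi (b m); congr inR.
  exact: subf_mul_div.
(* Colours seen at levels up to [s], cut off just after the current colour so that the sum is finite
   and includes it. *)
pose wt s psi := \sum_(0 <= k < (col s psi).+1 |
  `[< exists t, le t s /\ col t psi = k >]) hpow k.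
(* The case [s = s'] gives independence of the representative; [s < s'] lets [psi] be replaced by
   its extension. *)
have wt_congr s psi psi' s' : iso_rep (a s) (r s) psi -> iso_rep (a s') (r s') psi' ->
    le s s' -> extends_on (a s) psi' psi -> wt s psi = wt s psi'.
  move=> ip ip' ss' E.
  have cE t : le t s -> col t psi = col t psi'.
    move=> ts; apply: (@col_congr t psi psi' s s') => //.
      by case: ts => [->//|ts]; right; case: ss' => [<-//|]; apply: lt_trans ts.
    move=> l lt_; rewrite -opprB; apply: inRN; apply: E.
    apply: b_in_a; case: lt_ ts => [->//|lt_] [<-|]; first by right.
    by right; apply: lt_trans lt_ _.
  rewrite /wt cE; last by left.
  apply: eq_bigl => k; congr asbool; apply/propext.
  by split=> -[t [ts <-]]; exists t; rewrite cE.
exists wt; split=> [s psi psi' ip ip' E|s t psi phi st ip ip' E].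
  apply: (wt_congr s psi psi' s) => //; first by left.
  by move=> x xc; rewrite -opprB; apply: inRN; apply: E.
rewrite (wt_congr s psi phi t) //; last by right.
(* The colour of [phi] at level [t] is the new element: it occurs at no level up to [s]. *)
apply: subset_weight_lt.
- move=> k /asboolP[u [us uk]]; apply/asboolP; exists u; split=> //.
  by right; case: us => [->//|us]; apply: lt_trans st.
- by apply/asboolP; exists t; split=> //; left.
- apply/asboolPn => -[u [us]]; apply: col_neq => //.
  by case: us => [->//|us]; apply: lt_trans st.
Qed.

End Tower.

Unset Implicit Arguments.

Theorem mainTheorem7 (R : idomainType) (HR : valuation_domain R)
    (Hcard : card_aleph1 R)
    (J : {fraction R} -> Prop) (W : Type) (lt : W -> W -> Prop)
    (HW : omega1_order lt) (r : W -> R)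
    (HJ : type_presentation J lt r) (Hess : ess_countable lt r)
    (HnJ : ~ countably_generated J) :
  exists U : lmodType R,
    [/\ uniserial U, has_type U J & explicitly_nonstandard U lt r].
Proof.
case: HJ => _ _ r0 r_dvd JP; have [g0 r_count] := Hess.
have [g g0g] := omega1_unbounded HW g0.
have [lim [lam [num [[lim_g lim_ge] lim_cof lamP lim_inf lam_num]]]] := limit_levels HW g.
have lt_trans x y z : lt x y -> lt y z -> lt x z by case: HW => _ [+ _]; apply.
have r_lim s : lim s -> ~ dvd (r s) 1.
  move=> ls s1; apply: (r_nonunit r_dvd g0g).
  by case: (lim_ge _ ls) => [->//|/r_dvd[gs _]]; apply: dvd_trans s1.
have [c [f [c_unit c_coh f_congr f_mono]]] :=
  specialized_cocycle HR HW r_dvd g0g lim_ge r_count lim_inf.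
have sval_trans (s t u : {s | lim s}) :
  lt (sval s) (sval t) -> lt (sval t) (sval u) -> lt (sval s) (sval u) by apply: lt_trans.
have sval_total (s t : {s | lim s}) :
    lt (sval s) (sval t) \/ s = t \/ lt (sval t) (sval s).
  by apply: sig_total; case: HW => _ [_ []].
have sval_ub (s : {s | lim s}) : exists t : {s | lim s}, lt (sval s) (sval t).
  by have [t [lt_ st]] := lim_cof (sval s); exists (exist _ t lt_).
have [U [b [b_gen b_lift b_ann]]] := twisted_limit (exist _ g lim_g) sval_trans
  sval_total sval_ub (fun s => r0 (sval s)) (fun s t st => (r_dvd _ _ st).1)
  c_unit c_coh.
exists U; split.
- exact: (tower_uniserial HR HW r_dvd lim_cof b_gen b_lift).
- exact: (tower_has_type HR HW r0 r_dvd lim_cof r_lim c_unit b_gen b_lift b_ann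
            (exist _ g lim_g) JP).
- split; first exact: (tower_ann_ex HW r0 r_dvd lim_cof b_ann).
  move=> a a_ann.
  exact: (tower_special HR HW r0 r_dvd lim_cof r_lim b_gen b_lift b_ann a_ann
            lamP lam_num f_congr f_mono).
Qed.
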